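(* Assume the setting and assumptions described in the context (D-SGD on $n$ nodes with stochastic-gradient assumptions (i)-(iv), and neighborhood matrix $M$ defined from $W$ and $\gamma\in[0,1)$ with all diagonal entries equal to $n_W(\gamma)^{-1}$). Let $\omega\in[0,1]$ and let the learning rate $\eta>0$ satisfy $$ \eta\le\min\left(\frac{\beta(\gamma)\,\omega}{L},\ \frac{1}{4\left(\left[n_W(\gamma)^{-1}+\omega\right]\zeta+L\right)}\right). $$ Let $x^\star_\eta\in\mathbb{R}^{nd}$ be a fixed point, i.e. $\eta\nabla F(x^\star_\eta)+L_W x^\star_\eta=0$, and let $$ \mathcal{L}^{(t)}=\|x^{(t)}-x^\star_\eta\|_M^2+\omega\|x^{(t)}-x^\star_\eta\|_{L_M}^2=(1-\omega)\|x^{(t)}-x^\star_\eta\|_M^2+\omega\|x^{(t)}-x^\star_\eta\|^2 . $$ Then the iterates of D-SGD satisfy, for every $t\ge 0$, $$ \mathbb{E}\big[\mathcal{L}^{(t+1)}\,\big|\,x^{(t)}\big]\le(1-\eta\mu)\,\mathcal{L}^{(t)}+\eta^2\sigma_M^2, $$ where $$ \sigma_M^2=2\left[(1-\omega)n_W(\gamma)^{-1}+\omega\right]\mathbb{E}\left[\|\nabla F_{\xi^{(t)}}(x^\star_\eta)-\nabla F(x^\star_\eta)\|^2\right]. $$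
   Context: Problem and algorithm. There are $n$ nodes; node $i$ has a local objective $f_i:\mathbb{R}^d\to\mathbb{R}$. For stacked $x=(x_1,\dots,x_n)\in\mathbb{R}^{nd}$, $F(x)=\sum_{i=1}^n f_i(x_i)$. $W=(w_{ij})\in\mathbb{R}^{n\times n}$ is a symmetric doubly stochastic gossip matrix (nonnegative entries); by abuse of notation $W$ also denotes $W\otimes I_d$ acting on $\mathbb{R}^{nd}$, and similarly for the matrices below. Put $L_W=I-W$. D-SGD with learning rate $\eta$ is $$ x^{(t+1)}=x^{(t)}-\left[\eta\nabla F_{\xi^{(t)}}(x^{(t)})+L_W x^{(t)}\right],\qquad (\nabla F_{\xi^{(t)}}(x))_i=\nabla f_{\xi_i^{(t)}}(x_i), $$ from a deterministic $x^{(0)}$, where $f_{\xi_i^{(t)}}$ is the random function sampled by node $i$ at time $t$ (its distribution does not depend on $t$). For a symmetric positive semidefinite matrix $A$, $\|x\|_A^2=x^\top A x$. The Bregman divergence is $D_f(x,y)=f(x)-f(y)-\nabla f(y)^\top(x-y)$. Stochastic-gradient assumptions. (i) The samples $\xi_i^{(t)}$ are independent across times and across nodes. (ii) Stochastic gradients are locally unbiased: $\mathbb{E}[f_{\xi_i^{(t)}}]=f_i$ (and $\mathbb{E}[\nabla f_{\xi_i^{(t)}}]=\nabla f_i$) for all $t,i$. (iii) Each $f_{\xi_i^{(t)}}$ is convex and $\zeta_\xi$-smooth (with a possibly sample-dependent constant $\zeta_\xi$), and $\mathbb{E}[\zeta_\xi D_{f_\xi}(x,y)]\le\zeta D_{f_i}(x,y)$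 for all $x,y\in\mathbb{R}^d$ and all $i$, where $\xi=\xi_i^{(t)}$. (iv) Every $f_i$ is $\mu$-strongly convex with $\mu\ge 0$ and $L$-smooth. Neighborhood matrix. For a decay parameter $\gamma\in[0,1)$, $$ M=(1-\gamma)\sum_{k=1}^\infty\gamma^{k-1}W^{2k}=(1-\gamma)W^2(I-\gamma W^2)^{-1},\qquad L_M=I-M. $$ It is assumed that all diagonal entries of (the $n\times n$ matrix) $M$ are equal: $M_{ii}=M_{jj}$ for all $i,j$. Then $M_{ii}^{-1}=n_W(\gamma)$, where $n_W(\gamma)=\frac{1}{1-\gamma}\Big/\Big(\frac1n\sum_{i=1}^n\frac{\lambda_i^2}{1-\gamma\lambda_i^2}\Big)$ is the effective number of neighbors and $\lambda_i$ are the eigenvalues of $W$. The constant $\beta(\gamma)>0$ is such that $L_M\preccurlyeq\beta(\gamma)^{-1}L_W W$ (positive semidefinite order). *)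

(* Defs.v *)
From HB Require Import structures.
From mathcomp Require Import all_boot all_order all_algebra.
From mathcomp Require Import all_classical all_reals all_analysis.
From mathcomp Require Import measurable_realfun.
Export numFieldNormedType.Exports.

Set Implicit Arguments.
Unset Strict Implicit.
Unset Printing Implicit Defensive.

Import Order.TTheory GRing.Theory Num.Theory.
Local Open Scope classical_set_scope.
Local Open Scope ring_scope.

(** A stacked vector [x = (x_1, ..., x_n)] of [R^(nd)] is the matrix
    [x : 'M[R]_(n, d)] whose [i]-th row is [x_i]; the operator [A (x) I_d] on
    [R^(nd)] is then [x |-> A *m x].  The topology on matrices is the one of
    the sup norm; the Euclidean norm is [enorm]. *)

Section euclidean.
Context {R : realType}.

Definition dot {m n} (x y : 'M[R]_(m, n)) : R :=
  \sum_(i < m) \sum_(j < n) x i j * y i j.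

Definition sqnorm {m n} (x : 'M[R]_(m, n)) : R := dot x x.

Definition enorm {m n} (x : 'M[R]_(m, n)) : R := Num.sqrt (sqnorm x).

(** [||x||_A ^ 2] *)
Definition qnorm {m n} (A : 'M[R]_m) (x : 'M[R]_(m, n)) : R := dot x (A *m x).

Definition psdmx {n} (A : 'M[R]_n) : Prop :=
  A^T = A /\ forall v : 'cV[R]_n, 0 <= qnorm A v.

Definition loewner_le {n} (A B : 'M[R]_n) : Prop := psdmx (B - A).

End euclidean.

Section functions.
Context {R : realType}.

Definition grad {m n} (f : 'M[R]_(m, n) -> R) (x : 'M[R]_(m, n)) :
    'M[R]_(m, n) :=
  \matrix_(i, j) 'D_(delta_mx i j) f x.

Definition bregman {m n} (f : 'M[R]_(m, n) -> R) (x y : 'M[R]_(m, n)) : R :=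
  f x - f y - dot (grad f y) (x - y).

Definition smooth {m n} (c : R) (f : 'M[R]_(m, n) -> R) : Prop :=
  (forall x, differentiable f x) /\
  (forall x y, enorm (grad f x - grad f y) <= c * enorm (x - y)).

Definition convex {m n} (f : 'M[R]_(m, n) -> R) : Prop :=
  convex_function setT f.

Definition strongly_convex {m n} (mu : R) (f : 'M[R]_(m, n) -> R) : Prop :=
  convex (fun x => f x - mu / 2 * sqnorm x).

End functions.

Section gossip.
Context {R : realType} {n : nat}.

Definition doubly_stochastic (W : 'M[R]_n) : Prop :=
  [/\ forall i j, 0 <= W i j,
      forall i, \sum_j W i j = 1 &
      forall j, \sum_i W i j = 1].

Definition laplacian (A : 'M[R]_n) : 'M[R]_n := 1%:M - A.

(** The series of matrices converges entrywise for [W] symmetric doubly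
    stochastic and [0 <= gamma < 1]. *)
Definition neighborhood (W : 'M[R]_n) (gamma : R) : 'M[R]_n :=
  \matrix_(i, j)
    ((1 - gamma) * \big[+%R/0]_(1 <= k <oo) (gamma ^+ k.-1 * (W ^+ (2 * k)) i j)).

(** With multiplicity; [char_poly W] splits over [R] since [W] is symmetric. *)
Definition eigenvalues_of (W : 'M[R]_n) (lambda : 'I_n -> R) : Prop :=
  char_poly W = \prod_(i < n) ('X - (lambda i)%:P).

Definition eff_neighbors (lambda : 'I_n -> R) (gamma : R) : R :=
  (1 / (1 - gamma)) /
  (1 / n%:R * \sum_(i < n) (lambda i ^+ 2 / (1 - gamma * lambda i ^+ 2))).

(** [y] stands for [x - xstar]. *)
Definition lyapunov {d} (W : 'M[R]_n) (gamma omega : R) (y : 'M[R]_(n, d)) : R :=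
  qnorm (neighborhood W gamma) y
  + omega * qnorm (laplacian (neighborhood W gamma)) y.

Lemma lyapunovE d (W : 'M[R]_n) (gamma omega : R) (y : 'M[R]_(n, d)) :
  lyapunov W gamma omega y =
  (1 - omega) * qnorm (neighborhood W gamma) y + omega * sqnorm y.
Proof.
rewrite /lyapunov /laplacian; move: (neighborhood W gamma) => M.
suff -> : qnorm (1%:M - M) y = sqnorm y - qnorm M y.
  by rewrite mulrBr mulrBl mul1r addrCA addrC.
rewrite /qnorm /sqnorm /dot mulmxBl mul1mx -sumrB; apply: eq_bigr => i _.
by rewrite -sumrB; apply: eq_bigr => j _; rewrite !mxE mulrBr.
Qed.

End gossip.

Section dsgd.
Context {R : realType} {n d : nat} {Xi : Type}.

Definition total_obj (f : 'I_n -> 'rV[R]_d -> R) (x : 'M[R]_(n, d)) : R :=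
  \sum_(i < n) f i (row i x).

(** [fs z] is the function attached to the sample [z]; node [i] uses the
    sample [z i]. *)
Definition stoch_grad (fs : Xi -> 'rV[R]_d -> R) (z : 'I_n -> Xi)
    (x : 'M[R]_(n, d)) : 'M[R]_(n, d) :=
  \matrix_(i < n) grad (fs (z i)) (row i x).

Fixpoint dsgd (W : 'M[R]_n) (eta : R) (fs : Xi -> 'rV[R]_d -> R)
    (z : nat -> 'I_n -> Xi) (x0 : 'M[R]_(n, d)) (t : nat) : 'M[R]_(n, d) :=
  if t is t'.+1 then
    let x := dsgd W eta fs z x0 t' in
    x - (eta *: stoch_grad fs (z t') x + laplacian W *m x)
  else x0.

End dsgd.

Section probability.
Context {disp : measure_display} {Omega : measurableType disp} {R : realType}.
Variable P : probability Omega R.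

(** Mutual independence of a family: the product rule holds on every finite
    subfamily. *)
Definition independent_family {I : eqType} {disp' : measure_display}
    {T : measurableType disp'} (X : I -> Omega -> T) : Prop :=
  forall (s : seq I) (A : I -> set T), uniq s ->
    (forall i, measurable (A i)) ->
    P (\big[setI/setT]_(i <- s) (X i @^-1` A i)) =
    (\big[*%E/1%E]_(i <- s) P (X i @^-1` A i)).

(** [sigma(X)]: the Borel sigma-algebra of matrices is generated by the
    entries. *)
Definition sigma_mx {m n} (X : Omega -> 'M[R]_(m, n)) : set (set Omega) :=
  <<s [set A | exists i j (B : set R),
         measurable B /\ A = (fun s => X s i j) @^-1` B] >>.

(** [Y] is a version of [E[X | G]].  Meant for [X] nonnegative, whose
    expectation may be infinite; [Y] is then nonnegative almost surely. *)
Definition is_cond_exp (G : set (set Omega)) (X Y : Omega -> \bar R) : Prop :=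
  (forall B : set (\bar R), measurable B -> G (Y @^-1` B)) /\
  (forall A, G A -> (\int[P]_(s in A) Y s = \int[P]_(s in A) X s)%E).

End probability.

(* Main.v *)
(** With [A = M + omega L_M], [y = x - xstar] and [D] the sum over the nodes of
    the Bregman divergences [D_(f_i)(xstar_i, x_i)], independence across nodes
    replaces [A] by its constant diagonal [a] in the variance of the stochastic
    gradient, so that by cocoercivity the noise costs at most
    [4 eta^2 (L + a zeta) D + eta^2 sigma_M^2 <= eta D + eta^2 sigma_M^2].
    By the three-point identity at [u = xstar + A W y], the cross term
    [-2 eta <A W y, grad F(x) - grad F(xstar)>] equals
    [2 eta (D_F(u, x) - D_F(xstar, x) - D_F(u, xstar))].  Smoothness and strong
    convexity turn what remains into a quadratic form in [y] that is diagonal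
    in an eigenbasis of [W], and its sign is a scalar inequality at each
    eigenvalue.  Finally [x^(t)] depends only on the samples before time [t],
    so Tonelli's theorem for the two independent sigma-algebras generated by
    the samples before [t] and at [t] reduces the conditional statement to a
    deterministic [x]. *)

Require Import Defs.
From HB Require Import structures.
From mathcomp Require Import all_boot all_order all_algebra.
From mathcomp Require Import all_classical all_reals all_analysis.
From mathcomp Require Import measurable_realfun.
From mathcomp Require Import ring lra.
Import Order.TTheory GRing.Theory Num.Theory.
Import numFieldNormedType.Exports.
Local Open Scope classical_set_scope.
Local Open Scope ring_scope.

(** * Euclidean structure and orthogonal diagonalization *)

(** Two obstacles shape the descent. Local gradients do not commute with [A W], so the cross term is
    not by itself a Bregman divergence. With [u - xstar = A W y] the only term of wrong sign is
    [D_F(u, x)], at most [L / 2] times the squared norm of [(1 - A W) y]. This vanishes where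
    [w = 1], since there [a = 1]; elsewhere it is paid by the gossip gain [a (1 - w^2)], and
    [eta L <= beta omega] makes the payment sufficient. Of the [2 eta D] produced by the identity,
    one half absorbs the noise and the other half supplies strong convexity. The 4 in the step size
    is a 2 from splitting the stochastic gradient at [xstar] times a 2 from cocoercivity. On the
    probabilistic side, no hypothesis bounds the variance at [xstar], so an infinite [sigma_M^2] is
    set apart before real-valued integrals are used. The samples give measurability only at each
    fixed point; evaluating gradients at the random iterate requires a Caratheodory argument based
    on their continuity. *)

Section dot_theory.
Context {R : realType} {m n : nat}.
Implicit Types (x y z : 'M[R]_(m, n)) (A B : 'M[R]_m).

Lemma entryB x y i j : (x - y) i j = x i j - y i j.
Proof. by rewrite !mxE. Qed.

Lemma dot_trace x y : dot x y = \tr (x *m y^T).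
Proof.
by apply: eq_bigr => i _; rewrite mxE; apply: eq_bigr => j _; rewrite mxE.
Qed.

Lemma dotC x y : dot x y = dot y x.
Proof. by rewrite !dot_trace -mxtrace_tr trmx_mul trmxK. Qed.

Lemma dotDl x y z : dot (x + y) z = dot x z + dot y z.
Proof. by rewrite !dot_trace mulmxDl mxtraceD. Qed.

Lemma dotZl a x y : dot (a *: x) y = a * dot x y.
Proof. by rewrite !dot_trace -scalemxAl mxtraceZ. Qed.

Lemma dotNl x y : dot (- x) y = - dot x y.
Proof. by rewrite -scaleN1r dotZl mulN1r. Qed.

Lemma dotBl x y z : dot (x - y) z = dot x z - dot y z.
Proof. by rewrite dotDl dotNl. Qed.

Lemma dotDr x y z : dot x (y + z) = dot x y + dot x z.
Proof. by rewrite dotC dotDl !(dotC x). Qed.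

Lemma dotZr a x y : dot x (a *: y) = a * dot x y.
Proof. by rewrite dotC dotZl dotC. Qed.

Lemma dotNr x y : dot x (- y) = - dot x y.
Proof. by rewrite dotC dotNl dotC. Qed.

Lemma dotBr x y z : dot x (y - z) = dot x y - dot x z.
Proof. by rewrite dotDr dotNr. Qed.

Lemma dot0l y : dot 0 y = 0.
Proof. by rewrite -[in LHS](scale0r (0 : 'M[R]_(m, n))) dotZl mul0r. Qed.

Lemma dot0r x : dot x 0 = 0.
Proof. by rewrite dotC dot0l. Qed.

Lemma dot_rows x y : dot x y = \sum_i dot (row i x) (row i y).
Proof.
apply: eq_bigr => i _; rewrite /dot big_ord1.
by apply: eq_bigr => j _; rewrite !mxE.
Qed.

Lemma dot_mulmxl A x y : dot (A *m x) y = dot x (A^T *m y).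
Proof. by rewrite !dot_trace trmx_mul trmxK -mulmxA mxtrace_mulC -mulmxA. Qed.

Lemma sqnorm_ge0 x : 0 <= sqnorm x.
Proof.
by apply: sumr_ge0 => i _; apply: sumr_ge0 => j _; rewrite -expr2 sqr_ge0.
Qed.

Lemma sqnorm_eq0 x : sqnorm x = 0 -> x = 0.
Proof.
move=> x0; apply/matrixP => i j; rewrite mxE; apply/eqP; rewrite -sqrf_eq0.
have ge0 k : 0 <= \sum_l x k l * x k l.
  by apply: sumr_ge0 => l _; rewrite -expr2 sqr_ge0.
have /eqP xi0 := x0; rewrite [_ == _]psumr_eq0 // in xi0.
move/allP : xi0 => /(_ i (mem_index_enum _)) /=.
rewrite psumr_eq0 => [/allP/(_ j (mem_index_enum _))//|l _].
by rewrite -expr2 sqr_ge0.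
Qed.

Lemma sqr_entry_le x i j : x i j ^+ 2 <= sqnorm x.
Proof.
rewrite /sqnorm /dot (bigD1 i)//= (bigD1 j)//= -expr2 -addrA lerDl addr_ge0//.
  by apply: sumr_ge0 => k _; rewrite -expr2 sqr_ge0.
by apply: sumr_ge0 => k _; apply: sumr_ge0 => l _; rewrite -expr2 sqr_ge0.
Qed.

Lemma sqnorm_rows x : sqnorm x = \sum_i sqnorm (row i x).
Proof. exact: dot_rows. Qed.

Lemma sqnormN x : sqnorm (- x) = sqnorm x.
Proof. by rewrite /sqnorm dotNl dotNr opprK. Qed.

Lemma sqnormZ a x : sqnorm (a *: x) = a ^+ 2 * sqnorm x.
Proof. by rewrite /sqnorm dotZl dotZr mulrA -expr2. Qed.

Lemma sqnormD x y : sqnorm (x + y) = sqnorm x + 2 * dot x y + sqnorm y.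
Proof. by rewrite /sqnorm !dotDl !dotDr (dotC y x); ring. Qed.

Lemma enorm_ge0 x : 0 <= enorm x.
Proof. exact: sqrtr_ge0. Qed.

Lemma sqr_enorm x : enorm x ^+ 2 = sqnorm x.
Proof. by rewrite sqr_sqrtr// sqnorm_ge0. Qed.

Lemma enormZ a x : enorm (a *: x) = `|a| * enorm x.
Proof. by rewrite /enorm sqnormZ sqrtrM ?sqr_ge0// sqrtr_sqr. Qed.

Lemma dot_le_enorm x y : dot x y <= enorm x * enorm y.
Proof.
have [y0|y_neq0] := eqVneq (sqnorm y) 0.
  by rewrite (sqnorm_eq0 _ y0) dot0r mulr_ge0// sqrtr_ge0.
have y_gt0 : 0 < sqnorm y by rewrite lt_neqAle eq_sym y_neq0 sqnorm_ge0.
apply: (le_trans (ler_norm _)).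
rewrite -(@ler_pXn2r _ 2) ?nnegrE ?mulr_ge0 ?enorm_ge0//.
rewrite exprMn !sqr_enorm real_normK ?num_real//.
have := sqnorm_ge0 (x - (dot x y / sqnorm y) *: y).
rewrite sqnormD sqnormN sqnormZ dotNr dotZr.
rewrite -(ler_pM2r y_gt0) mul0r.
suff -> : (sqnorm x + 2 * - (dot x y / sqnorm y * dot x y) +
  (dot x y / sqnorm y) ^+ 2 * sqnorm y) * sqnorm y =
  sqnorm x * sqnorm y - dot x y ^+ 2 by rewrite subr_ge0.
by field.
Qed.

Lemma qnormD A x y : A^T = A ->
  qnorm A (x + y) = qnorm A x + 2 * dot (A *m x) y + qnorm A y.
Proof.
move=> As; rewrite /qnorm mulmxDr !dotDl !dotDr (dotC (A *m x)).
by rewrite [dot y _]dotC dot_mulmxl As; ring.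
Qed.

Lemma qnormZ A a x : qnorm A (a *: x) = a ^+ 2 * qnorm A x.
Proof. by rewrite /qnorm -scalemxAr dotZl dotZr mulrA -expr2. Qed.

Lemma qnorm_opD A B x : qnorm (A + B) x = qnorm A x + qnorm B x.
Proof. by rewrite /qnorm mulmxDl dotDr. Qed.

Lemma qnorm_opZ a A x : qnorm (a *: A) x = a * qnorm A x.
Proof. by rewrite /qnorm -scalemxAl dotZr. Qed.

Lemma qnorm1 x : qnorm 1%:M x = sqnorm x.
Proof. by rewrite /qnorm mul1mx. Qed.

End dot_theory.

Section orthogonal_diagonalization.
Context {R : realType}.

(** Householder reflection along [u = v - e]. Both vectors are unit, so [v *m u^T] is half of
    [u *m u^T], and the rank-one correction removes exactly [u] from [v]. *)
Lemma reflection_to_delta n (v : 'rV[R]_n.+1) : v *m v^T = 1%:M ->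
  exists H : 'M[R]_n.+1,
    [/\ H^T = H, H *m H = 1%:M & v *m H = delta_mx 0 0].
Proof.
move=> v1; pose e : 'rV[R]_n.+1 := delta_mx 0 0.
have [->|u0] := eqVneq v e.
  by exists 1%:M; rewrite trmx1 !mulmx1.
pose u := v - e; pose c := 2 - 2 * v 0 0.
have ee : e *m e^T = 1%:M.
  by apply/matrixP => i j; rewrite !ord1 trmx_delta mul_delta_mx !mxE !eqxx.
have ve : v *m e^T = (v 0 0)%:M.
  by apply/matrixP => i j; rewrite !ord1 trmx_delta -colE !mxE.
have ev : e *m v^T = (v 0 0)%:M.
  by rewrite -[LHS]trmxK trmx_mul trmxK ve tr_scalar_mx.
have uu : u *m u^T = c%:M.
  rewrite /u linearB /= mulmxBl !mulmxBr v1 ve ev ee.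
  by apply/matrixP => i j; rewrite !ord1 !mxE !eqxx /c; ring.
have vu : v *m u^T = (c / 2)%:M.
  rewrite /u linearB /= mulmxBr v1 ve.
  by apply/matrixP => i j; rewrite !ord1 !mxE !eqxx /c; field.
have c0 : c != 0.
  apply: contraNneq u0 => c0; rewrite -subr_eq0; apply/eqP/sqnorm_eq0.
  by rewrite -/u /sqnorm dot_trace uu c0 mxtrace_scalar.
exists (1%:M - (2 / c) *: (u^T *m u)); split.
- by rewrite linearB /= linearZ /= trmx_mul trmxK trmx1.
- have PP : (u^T *m u) *m (u^T *m u) = c *: (u^T *m u).
    by rewrite mulmxA -(mulmxA u^T) uu mul_mx_scalar -scalemxAl.
  move: PP; set P := u^T *m u => PP.
  rewrite mulmxBl mul1mx -scalemxAl mulmxBr mulmx1 -scalemxAr PP.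
  by apply/matrixP => i j; rewrite !mxE; field; exact: c0.
- rewrite mulmxBr mulmx1 -scalemxAr mulmxA vu mul_scalar_mx scalerA.
  by rewrite (_ : 2 / c * _ = 1) ?scale1r ?subKr//; field.
Qed.

Lemma unit_eigenvector n (W : 'M[R]_n) a : root (char_poly W) a ->
  exists v : 'rV[R]_n, v *m v^T = 1%:M /\ v *m W = a *: v.
Proof.
rewrite -eigenvalue_root_char => /eigenvalueP[v vW v0].
have s_gt0 : 0 < sqnorm v.
  by rewrite lt_neqAle sqnorm_ge0 andbT eq_sym; apply: contra_neq v0 => /sqnorm_eq0.
exists ((enorm v)^-1 *: v); split; last first.
  by rewrite -scalemxAl vW !scalerA mulrC.
rewrite -scalemxAl linearZ /= -scalemxAr scalerA.
have -> : v *m v^T = (sqnorm v)%:M.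
  by rewrite [LHS]mx11_scalar /sqnorm dot_trace /mxtrace big_ord1.
rewrite scale_scalar_mx -expr2 exprVn sqr_enorm mulVf ?gt_eqF//.
Qed.

(** Deflation: a reflection carries a unit eigenvector to the first basis vector, symmetry clears
    the first column along with the first row, and cancelling ['X - l 0] leaves the characteristic
    polynomial of the remaining block. Generalizing over [l] makes the diagonal the given family
    itself, not a permutation of it. *)
Lemma symmetric_diagonalization n (W : 'M[R]_n) (l : 'I_n -> R) :
  W^T = W -> eigenvalues_of W l ->
  exists Q : 'M[R]_n, Q^T *m Q = 1%:M /\ W = Q^T *m diag_mx (\row_i l i) *m Q.
Proof.
elim: n W l => [W l _ _|n IH W l Ws cW].
  by exists 1%:M; split; apply/matrixP => -[].
have /unit_eigenvector[v [vv vW]] : root (char_poly W) (l 0).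
  by rewrite [char_poly W]cW big_ord_recl rootM root_XsubC eqxx.
have [H [Hs HH vH]] := reflection_to_delta _ _ vv.
pose W' : 'M[R]_(1 + n) := H *m W *m H.
have eH : delta_mx 0 0 *m H = v by rewrite -vH -mulmxA HH mulmx1.
have rowW' : row 0 W' = l 0 *: delta_mx 0 0.
  by rewrite rowE /W' !mulmxA eH vW -scalemxAl vH.
have W's : W'^T = W' by rewrite /W' !trmx_mul Hs Ws mulmxA.
have W'E i : W' 0 i = l 0 *+ (i == 0).
  by have := congr1 (fun x : 'rV_(1 + n) => x 0 i) rowW'; rewrite !mxE eqxx /= mulr_natr.
have WE : W = H *m W' *m H by rewrite /W' !mulmxA HH mul1mx -mulmxA HH mulmx1.
have cW' : char_poly W' = char_poly W.
  rewrite /char_poly /char_poly_mx /W'.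
  have -> : 'X%:M - map_mx polyC (H *m W *m H) =
      map_mx polyC H *m ('X%:M - map_mx polyC W) *m map_mx polyC H.
    rewrite !map_mxM /= mulmxBr mulmxBl; congr (_ - _).
    rewrite -mulmxA mul_scalar_mx -scalemxAr -map_mxM HH /=.
    by rewrite map_scalar_mx scale_scalar_mx mulr1.
  rewrite !det_mulmx mulrAC -det_mulmx -map_mxM HH map_mx1.
  by rewrite det1 mul1r.
clearbody W'; have W'block : W' = block_mx (l 0)%:M 0 0 (drsubmx W').
  rewrite -[LHS](@submxK _ 1 n 1 n); congr block_mx.
  - by apply/matrixP => i j; rewrite !ord1 !mxE !lshift0 W'E.
  - apply/matrixP => i j; rewrite !ord1 !mxE lshift0 W'E.
    by rewrite -val_eqE /= mulr0n.
  - apply/matrixP => i j; rewrite !ord1 !mxE lshift0 -W's mxE W'E.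
    by rewrite -val_eqE /= mulr0n.

have W1s : (drsubmx W')^T = drsubmx W' by rewrite trmx_drsub W's.
have cW1 : eigenvalues_of (drsubmx W') (fun i => l (lift 0 i)).
  have : ('X - (l 0)%:P) * char_poly (drsubmx W') =
      ('X - (l 0)%:P) * \prod_(i < n) ('X - (l (lift 0 i))%:P).
    rewrite -(big_ord_recl n (fun i => 'X - (l i)%:P)) -cW -cW' [in RHS]W'block.
    rewrite [in RHS]/char_poly char_block_diag_mx det_ublock; congr (_ * _).
    by rewrite /char_poly_mx map_scalar_mx -raddfB det_scalar1.
  by apply: mulfI; rewrite polyXsubC_eq0.
have [Q [Q1 W1E]] := IH _ _ W1s cW1.
pose B : 'M[R]_(1 + n) := block_mx 1%:M 0 0 Q.
have BT : B^T = block_mx 1%:M 0 0 Q^T by rewrite tr_block_mx !trmx0 trmx1.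
have BB : B^T *m B = 1%:M.
  rewrite BT mulmx_block !mulmx0 !mul0mx !mulmx1 addr0 !add0r Q1.
  by rewrite -scalar_mx_block.
exists (B *m H); split.
  by rewrite trmx_mul Hs mulmxA -(mulmxA H) BB mulmx1.
rewrite WE W'block trmx_mul Hs -!mulmxA; congr (_ *m _); rewrite !mulmxA.
congr (_ *m _).
pose D : 'M[R]_(1 + n) := diag_mx (\row_i l i).
have DE : D = block_mx (l 0)%:M 0 0 (diag_mx (\row_i l (lift 0 i))).
  rewrite -[LHS](@submxK _ 1 n 1 n); congr block_mx; apply/matrixP => i j.
  - by rewrite !ord1 !mxE eqxx lshift0.
  - by rewrite !ord1 !mxE lshift0 -val_eqE /= mulr0n.
  - by rewrite !ord1 !mxE lshift0 -val_eqE /= mulr0n.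
  - by rewrite !mxE (inj_eq (@rshift_inj 1 n)) -rshift1.
transitivity (B^T *m D *m B : 'M[R]_(1 + n)); last by [].
rewrite DE BT !mulmx_block.
by rewrite !mulmx0 !mul0mx !mulmx1 !mul1mx !addr0 !add0r -W1E mul0mx.
Qed.

End orthogonal_diagonalization.
(** * Spectrum of the neighborhood matrix *)

Section spectral_calculus.
Context {R : realType} {n : nat}.
Implicit Types (Q : 'M[R]_n) (h g l : 'I_n -> R).

(** Functional calculus: for orthogonal [Q] and [W = spectral Q l], every function of [W] is
    obtained by applying it to [l], so products, traces and Loewner comparisons become scalar
    statements. *)
Definition spectral Q h : 'M[R]_n := Q^T *m diag_mx (\row_i h i) *m Q.

Lemma spectralE Q h i j : spectral Q h i j = \sum_k h k * (Q k i * Q k j).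
Proof.
rewrite /spectral mxE; apply: eq_bigr => k _.
by rewrite mul_mx_diag !mxE mulrAC mulrA mulrC mulrA.
Qed.

Lemma spectral_tr Q h : (spectral Q h)^T = spectral Q h.
Proof. by rewrite /spectral !trmx_mul trmxK tr_diag_mx mulmxA. Qed.

Lemma spectralD Q h g : spectral Q h + spectral Q g = spectral Q (fun i => h i + g i).
Proof.
apply/matrixP => i j; rewrite mxE !spectralE -big_split /=.
by apply: eq_bigr => k _; rewrite mulrDl.
Qed.

Lemma spectralZ Q a h : a *: spectral Q h = spectral Q (fun i => a * h i).
Proof.
apply/matrixP => i j; rewrite mxE !spectralE mulr_sumr.
by apply: eq_bigr => k _; rewrite mulrA.
Qed.

Lemma spectralB Q h g : spectral Q h - spectral Q g = spectral Q (fun i => h i - g i).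
Proof.
rewrite -scaleN1r spectralZ spectralD; congr spectral.
by apply/funext => i; rewrite mulN1r.
Qed.

Context {Q : 'M[R]_n} (Q1 : Q^T *m Q = 1%:M).

Lemma spectral1 : spectral Q (fun=> 1) = 1%:M.
Proof.
rewrite /spectral; have -> : \row_i 1 = const_mx 1 :> 'rV[R]_n.
  by apply/matrixP => i j; rewrite !mxE.
by rewrite diag_const_mx mulmx1.
Qed.

Lemma spectralM h g : spectral Q h *m spectral Q g = spectral Q (fun i => h i * g i).
Proof.
rewrite /spectral !mulmxA -(mulmxA _ Q) (mulmx1C Q1) mulmx1 -(mulmxA Q^T).
rewrite mulmx_diag; congr (_ *m diag_mx _ *m _).
by apply/matrixP => i j; rewrite !mxE.
Qed.

Lemma spectralX h k : spectral Q h ^+ k = spectral Q (fun i => h i ^+ k).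
Proof.
elim: k => [|k IH].
  transitivity (1%:M : 'M[R]_n); first exact: expr0.
  by rewrite -spectral1; congr spectral; apply/funext => i; rewrite expr0.
rewrite exprS IH; apply: etrans (spectralM _ _) _.
by congr spectral; apply/funext => i; rewrite exprS.
Qed.

Lemma trace_spectral h : \tr (spectral Q h) = \sum_i h i.
Proof.
rewrite /spectral mxtrace_mulC mulmxA (mulmx1C Q1) mul1mx mxtrace_diag.
by apply: eq_bigr => i _; rewrite mxE.
Qed.

Lemma dot_spectral d h g (y : 'M[R]_(n, d)) :
  dot (spectral Q h *m y) (spectral Q g *m y) =
  \sum_i (h i * g i) * sqnorm (row i (Q *m y)).
Proof.
rewrite /spectral -!mulmxA dot_mulmxl trmxK !mulmxA (mulmx1C Q1) mul1mx -!mulmxA.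
rewrite dot_rows; apply: eq_bigr => i _.
have row_diag h' : row i (diag_mx (\row_j h' j) *m (Q *m y)) = h' i *: row i (Q *m y).
  by rewrite [in LHS]row_mul row_diag_mx -scalemxAl -rowE mxE.
by rewrite !row_diag dotZl dotZr mulrA.
Qed.

Lemma qnorm_spectral d h (y : 'M[R]_(n, d)) :
  qnorm (spectral Q h) y = \sum_i h i * sqnorm (row i (Q *m y)).
Proof.
have := dot_spectral _ (fun=> 1) h y; rewrite spectral1 mul1mx /qnorm => ->.
by apply: eq_bigr => i _; rewrite mul1r.
Qed.

Lemma sqnorm_spectral d (y : 'M[R]_(n, d)) :
  sqnorm y = \sum_i sqnorm (row i (Q *m y)).
Proof.
rewrite -qnorm1 -spectral1 qnorm_spectral.
by apply: eq_bigr => i _; rewrite mul1r.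
Qed.

(** On the [i]-th column of [Q^T] the quadratic form takes the value [h i]. *)
Lemma psdmx_spectral h i : psdmx (spectral Q h) -> 0 <= h i.
Proof.
move=> [_ /(_ (Q^T *m delta_mx i 0))].
rewrite qnorm_spectral mulmxA (mulmx1C Q1) mul1mx (bigD1 i)//=.
rewrite big1 => [|k ki]; last first.
  by rewrite /sqnorm /dot !big_ord1 !mxE (negbTE ki) !mulr0.
by rewrite /sqnorm /dot !big_ord1 !mxE !eqxx !mulr1 addr0.
Qed.

End spectral_calculus.

(** Maximum principle: at a coordinate [k] where [v] is largest in absolute value, [(W *m v) k] is a
    convex average of entries no larger than that one. *)
Lemma stochastic_eigenvalue {R : realType} {n : nat} (W : 'M[R]_n) (v : 'cV[R]_n) a :
  doubly_stochastic W -> W *m v = a *: v -> v != 0 -> `|a| <= 1.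
Proof.
move=> [W0 Wr _] Wv v0.
have [i vi0] : exists i, v i 0 != 0.
  apply/existsP; apply: contraNT v0; rewrite negb_exists => /forallP v0.
  by apply/eqP/matrixP => i j; rewrite ord1 mxE; apply/eqP; rewrite -[_ == _]negbK.
have [k _ kmax] := Order.TotalTheory.arg_maxP (fun j => `|v j 0|) (erefl : predT i).
have vk0 : 0 < `|v k 0| by rewrite (lt_le_trans _ (kmax i isT))// normr_gt0.
have : `|a| * `|v k 0| <= `|v k 0|.
  have -> : `|a| * `|v k 0| = `|\sum_j W k j * v j 0|.
    by rewrite -normrM; have := congr1 (fun x : 'cV_n => x k 0) Wv; rewrite !mxE => ->.
  rewrite -[leRHS]mul1r -(Wr k) mulr_suml; apply: le_trans (ler_norm_sum _ _ _) _.
  apply: ler_sum => j _; rewrite normrM ger0_norm//.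
  by rewrite ler_wpM2l//; exact: kmax.
by rewrite ger_pMl.
Qed.

Section neighborhood_spectrum.
Context {R : realType} {n : nat}.
Implicit Types (W Q : 'M[R]_n) (l : 'I_n -> R).

(** Closed form of [(1 - gamma)] times the sum over [k >= 1] of [gamma^(k-1) w^(2k)]. *)
Definition neighborhood_eigenvalue (gamma w : R) : R :=
  (1 - gamma) * (w ^+ 2 / (1 - gamma * w ^+ 2)).

Lemma sqr_eigenvalue_lt1 (gamma w : R) : 0 <= gamma < 1 -> `|w| <= 1 ->
  0 <= w ^+ 2 <= 1 /\ 0 < 1 - gamma * w ^+ 2.
Proof.
move=> /andP[g0 g1] w1.
have w2 : 0 <= w ^+ 2 <= 1.
  by rewrite sqr_ge0 -real_normK ?num_real// expr_le1.
by split => //; move: w2 => /andP[w2 w2']; nra.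
Qed.

(** The value is an average of the powers [w^(2k)], [k >= 1], none of which exceeds [w^2]. After
    clearing the denominator the gap is [gamma w^2 (1 - w^2)]. *)
Lemma neighborhood_eigenvalue_itv (gamma w : R) : 0 <= gamma < 1 -> `|w| <= 1 ->
  0 <= neighborhood_eigenvalue gamma w <= w ^+ 2.
Proof.
move=> hg w1; have [/andP[w2 w2'] d0] := sqr_eigenvalue_lt1 _ _ hg w1.
have /andP[g0 g1] := hg.
rewrite /neighborhood_eigenvalue mulrA; apply/andP; split.
  by apply: divr_ge0; [apply: mulr_ge0 => //; rewrite subr_ge0|]; exact: ltW.
rewrite ler_pdivrMr//.
have : 0 <= gamma * (w ^+ 2 * (1 - w ^+ 2)).
  by rewrite mulr_ge0// mulr_ge0// subr_ge0.
nra.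
Qed.

(** In the eigenbasis each entry is a finite combination of scalar geometric series of first term
    [w^2] and ratio [gamma w^2 < 1], so the limit is taken one eigenvalue at a time. *)
Lemma neighborhood_spectral W Q l gamma :
  Q^T *m Q = 1%:M -> W = spectral Q l -> (forall i, `|l i| <= 1) ->
  0 <= gamma < 1 ->
  neighborhood W gamma = spectral Q (fun i => neighborhood_eigenvalue gamma (l i)).
Proof.
move=> Q1 WE l1 hg; apply/matrixP => i j; rewrite mxE spectralE.
have /andP[g0 g1] := hg.
set c := fun k => Q k i * Q k j.
suff /(cvg_lim (@norm_hausdorff _ _)) -> :
    (\sum_(1 <= k < N) gamma ^+ k.-1 * (W ^+ (2 * k)) i j) @[N --> \oo] -->
    \sum_k (l k ^+ 2 / (1 - gamma * l k ^+ 2)) * c k.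
  by rewrite mulr_sumr; apply: eq_bigr => k _; exact: mulrA.
(* The series starts at [k = 1] and [geometric] at exponent 0; shifting the partial sums aligns
   them. *)
rewrite -(cvg_shiftS _).
have -> : (fun N => \sum_(1 <= k < N.+1) gamma ^+ k.-1 * (W ^+ (2 * k)) i j) =
    (fun N => \sum_k series (geometric (l k ^+ 2) (gamma * l k ^+ 2)) N * c k).
  apply/funext => N; rewrite big_add1 /=.
  under [RHS]eq_bigr do rewrite /series /= mulr_suml.
  rewrite exchange_big /=; apply: eq_bigr => k _.
  rewrite WE spectralX// spectralE mulr_sumr; apply: eq_bigr => m _.
  rewrite [LHS]mulrA /=; congr (_ * _).
  by rewrite exprMn -exprM mulnS exprD; ring.
apply: cvg_big => [|k _]; first exact: add_continuous.
apply: cvgMl; apply: cvg_geometric_series.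
have [/andP[w2 w2'] d0] := sqr_eigenvalue_lt1 _ _ hg (l1 k).
have g2 : 0 <= gamma * l k ^+ 2 by exact: mulr_ge0.
have d1 : gamma * l k ^+ 2 < 1 by rewrite -subr_gt0.
by rewrite (ger0_norm g2).
Qed.

(** A constant diagonal equals the trace over [n], that is, the mean eigenvalue of the neighborhood
    matrix. *)
Lemma eff_neighborsV W Q l gamma (i : 'I_n) :
  Q^T *m Q = 1%:M -> W = spectral Q l -> (forall i, `|l i| <= 1) ->
  0 <= gamma < 1 ->
  (forall i j, neighborhood W gamma i i = neighborhood W gamma j j) ->
  (eff_neighbors l gamma)^-1 = neighborhood W gamma i i.
Proof.
move=> Q1 WE l1 hg hM; have /andP[g0 g1] := hg.
have n0 : n%:R != 0 :> R by rewrite pnatr_eq0 -lt0n (leq_ltn_trans _ (ltn_ord i)).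
have tr : \tr (neighborhood W gamma) = n%:R * neighborhood W gamma i i.
  rewrite /mxtrace (eq_bigr _ (fun j _ => hM j i)) sumr_const card_ord.
  by rewrite mulr_natl.
rewrite [RHS](_ : _ = n%:R^-1 * \tr (neighborhood W gamma)); last first.
  by rewrite tr mulKf.
rewrite (neighborhood_spectral _ _ _ _ Q1 WE)// trace_spectral//.
rewrite /eff_neighbors invf_div !div1r mulrC -mulr_sumr mulrC invrK.
by rewrite -mulrA [X in _ * X]mulrC.
Qed.

End neighborhood_spectrum.

(* With the expectation and the Bregman terms estimated, the descent reduces to
   this inequality at each eigenvalue [w] of [W], where [m] and [a] are the
   corresponding eigenvalues of [M] and of [M + omega L_M], [p = eta L] and
   [q = eta mu].  It is affine in [q], so only [q = 0] and [q = p] matter. *)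
Lemma eigenvalue_contraction {R : realType} (w m beta omega p q : R) :
  `|w| <= 1 -> 0 <= m <= w ^+ 2 -> 0 < beta -> 0 <= omega <= 1 ->
  beta * (1 - m) <= (1 - w) * w -> 0 <= q <= p -> p <= beta * omega ->
  forall a, a = m + omega * (1 - m) ->
  a * w ^+ 2 + p * (1 - a * w) ^+ 2 - q / 2 - q * (a * w) ^+ 2 <= (1 - q) * a.
Proof.
rewrite ler_norml => /andP[wN1 w1] /andP[m0 mw] b0 homega hb /andP[q0 qp] pbo a aE.
have om0 : 0 <= omega by case/andP: homega.
have om1 : omega <= 1 by case/andP: homega.
have m1 : m <= 1 by nra.
have oa : omega <= a by rewrite aE; nra.
have ma : m <= a by rewrite aE; nra.
have a1 : a <= 1 by rewrite aE; nra.
clear aE.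
(* At [w = 1] the bound [hb] forces [m = 1], hence [a = 1], and only [0 <= q] is left. Otherwise
   [1 - w] may be divided out. *)
have [weq|wneq] := eqVneq w 1.
  rewrite weq in hb *.
  have : m = 1 by apply/eqP; rewrite eq_le m1 /=; nra.
  move=> meq; have -> : a = 1 by apply/eqP; rewrite eq_le a1 /= -meq.
  lra.
have {}w1 : w < 1 by rewrite lt_neqAle wneq.
have w0 : 0 <= w.
  have : 0 <= (1 - w) * w .
    by apply: le_trans hb; rewrite mulr_ge0 ?subr_ge0// ltW.
  by rewrite pmulr_rge0 ?subr_gt0.
(* From [m <= w^2], [hb] gives [beta (1 - w^2) <= w (1 - w)]; dividing by [1 - w] bounds [beta] by
   [w / (1 + w)], hence by one half. *)
have bw : beta * (1 + w) <= w.
  have : beta * (1 + w) * (1 - w) <= w * (1 - w).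
    have hbm : beta * m <= beta * w ^+ 2 by rewrite ler_wpM2l// ltW.
    nra.
  by rewrite ler_pM2r ?subr_gt0.
have b2 : beta <= 1 / 2 by nra.
have aw1 : 0 <= a * w <= 1 by apply/andP; split; nra.
have ww : 0 <= 1 - w ^+ 2 by nra.
(* [E0] and [E1] are the cases [q = 0] and [q = p] with [beta] in place of [p] and the factor [a]
   dropped on the right; [pa] restores both through [p <= beta * omega] and [omega <= a]. *)
have E0 : beta * (1 - a * w) ^+ 2 <= 1 - w ^+ 2.
  have h1 : beta * (1 - a * w) ^+ 2 <= beta * (1 - m * w).
    apply: (ler_wpM2l (ltW b0)); have : m * w <= a * w by rewrite ler_wpM2r.
    by move: aw1 => /andP[aw0 aw1]; nra.
  have h2 : beta * m * (1 - w) <= 1 / 2 * (1 - w).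
    by rewrite ler_wpM2r ?subr_ge0 1?ltW//; nra.
  by apply: le_trans h1 _; nra.
have E1 : beta * (a + 1 / 2 - 2 * (a * w)) <= 1 - w ^+ 2.
  (* The coefficient [1 - 2 * w] of [a] changes sign here. Below, [a <= 1] is the right bound;
     above, [m <= a] is, and the resulting [(1 - m) / 2] is controlled by [hb]. *)
  have [w2|w2] := lerP w (1 / 2).
    have h : a + 1 / 2 - 2 * (a * w) <= 3 / 2 - 2 * w by nra.
    have h' : beta * (3 / 2 - 2 * w) <= 1 / 2 * (3 / 2 - 2 * w).
      by rewrite ler_wpM2r//; lra.
    by have := ler_wpM2l (ltW b0) h; nra.
  have h : a + 1 / 2 - 2 * (a * w) <= (1 - m) / 2 + m * (3 / 2 - 2 * w).
    by have := ler_wpM2r (_ : 0 <= 2 * w - 1) ma; move=> /(_ ltac:(lra)); lra.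
  have h1' : beta * (m * (3 / 2 - 2 * w)) <= Num.max 0 (3 / 4 - w).
    rewrite le_max; have [w3|w3] := lerP (3 / 2 - 2 * w) 0.
      by apply/orP; left; rewrite pmulr_rle0// mulr_ge0_le0.
    apply/orP; right.
    have h3 : m * (3 / 2 - 2 * w) <= 3 / 2 - 2 * w by rewrite ger_pMl.
    have h4 : 0 <= m * (3 / 2 - 2 * w) by rewrite mulr_ge0// ltW.
    have := ler_wpM2r h4 b2; lra.
  have h2 := ler_wpM2l (ltW b0) h.
  apply: (le_trans h2); rewrite mulrDr.
  move: h1'; rewrite le_max => /orP[h1'|h1']; nra.
have pa r : beta * r <= 1 - w ^+ 2 -> p * r <= a * (1 - w ^+ 2).
  move=> hr; have [r0|r0] := lerP r 0.
    rewrite (@le_trans _ _ 0)//; first by rewrite mulr_ge0_le0// (le_trans q0).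
    by rewrite mulr_ge0// (le_trans m0).
  apply: (@le_trans _ _ (beta * omega * r)); first by rewrite ler_wpM2r// ltW.
  rewrite mulrAC mulrC; apply: (@le_trans _ _ (omega * (1 - w ^+ 2))).
    by rewrite ler_wpM2l.
  by rewrite ler_wpM2r.
have /pa := E0; have /pa := E1; set X := a * w; move=> H1 H0.
(* With everything on the left, [q] has coefficient [- (1 / 2 + X ^+ 2 - a)]: its sign decides
   whether [q = 0] ([H0]) or [q = p] ([H1]) is the worst case. *)
have [T0|T0] := lerP 0 (1 / 2 + X ^+ 2 - a).
  by have := mulr_ge0 q0 T0; nra.
have : p * (1 / 2 + X ^+ 2 - a) <= q * (1 / 2 + X ^+ 2 - a).
  by rewrite ler_nM2r.
nra.
Qed.

(** * Convex and smooth functions *)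

Section convex_smooth.
Context {R : realType} {m n : nat}.
Implicit Types (f : 'M[R]_(m, n) -> R) (u v w x y : 'M[R]_(m, n)).

Lemma derive_grad f x w : differentiable f x -> 'D_w f x = dot (grad f x) w.
Proof.
move=> df; rewrite deriveE// [in LHS](matrix_sum_delta w) linear_sum.
apply: eq_bigr => i _; rewrite linear_sum; apply: eq_bigr => j _.
by rewrite linearZ /= mxE deriveE// mulrC.
Qed.

Lemma strongly_convex_le mu f u v (s : R) : strongly_convex mu f -> 0 <= s <= 1 ->
  f (v + s *: (u - v)) <=
  f v + s * (f u - f v) - mu / 2 * (s * (1 - s)) * sqnorm (u - v).
Proof.
move=> fmu /andP[s0 s1].
have s01 : Itv.spec (@Itv.num_sem R) (Itv.Real `[0%Z, 1%Z]) s.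
  by rewrite /= /Itv.num_sem /= num_real in_itv /= s0 s1.
have := fmu (Itv.mk s01) u v; rewrite !inE => /(_ I I).
rewrite convRE /= => h.
have -> : v + s *: (u - v) = s *: u + (1 - s) *: v.
  by rewrite scalerBr scalerBl scale1r addrCA addrA.
have hs : sqnorm (s *: u + (1 - s) *: v) =
    s * sqnorm u + (1 - s) * sqnorm v - s * (1 - s) * sqnorm (u - v).
  rewrite !sqnormD !sqnormZ sqnormN dotNr dotZl dotZr.
  by move: (sqnorm u) (sqnorm v) (dot u v) => a b c; ring.
move: h; rewrite /conv /= -/(1 - s) => h.
have {}h : f (s *: u + (1 - s) *: v) - mu / 2 * sqnorm (s *: u + (1 - s) *: v) <=
    s * (f u - mu / 2 * sqnorm u) + (1 - s) * (f v - mu / 2 * sqnorm v) := h.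
rewrite hs in h; lra.
Qed.

(** Divide the chord inequality by the step and let it tend to 0 from the right; the quadratic gain
    carries a factor [1 - h], which tends to 1. *)
Lemma strongly_convex_bregman mu f u v : strongly_convex mu f ->
  differentiable f v -> mu / 2 * sqnorm (u - v) <= bregman f u v.
Proof.
move=> fmu df; set N := sqnorm (u - v).
have dfv : derivable f v (u - v) by exact: diff_derivable.
have cq : h^-1 *: (f (h *: (u - v) + v) - f v) @[h --> 0^'+] -->
    dot (grad f v) (u - v).
  rewrite -derive_grad//; apply: cvg_trans dfv.
  apply: cvg_app => A [e /= e0 He]; exists e => //= y ye y0.
  by apply: He => //; rewrite gt_eqF.
have cl : f u - f v - mu / 2 * ((1 - h) * N) @[h --> 0^'+] -->
    f u - f v - mu / 2 * ((1 - 0) * N).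
  apply: cvgB; first exact: cvg_cst.
  apply: cvgMr; apply: cvgMl; apply: cvgB; first exact: cvg_cst.
  exact: cvg_at_right_filter.
have : dot (grad f v) (u - v) <= f u - f v - mu / 2 * ((1 - 0) * N).
  apply: ler_cvg_to cq cl _; near=> h.
  have h0 : 0 < h by near: h; exact: nbhs_right_gt.
  have h1 : h <= 1 by near: h; exact: nbhs_right_le.
  have := strongly_convex_le _ _ u v h fmu; rewrite ltW// h1 => /(_ isT) hle.
  rewrite [leLHS]/(_ *: _) /= mulrC ler_pdivrMr// [_ + v]addrC.
  by move: hle; rewrite -/N; lra.
by rewrite /bregman; lra.
Unshelve. all: by end_near.
Qed.

Lemma is_derive_line f v w (s : R) : (forall x, differentiable f x) ->
  is_derive s 1 (fun t => f (v + t *: w)) (dot (grad f (v + s *: w)) w).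
Proof.
move=> df; rewrite -derive_grad//.
have E : (fun h : R => h^-1 *: (((fun t => f (v + t *: w)) \o shift s) (h *: 1) - f (v + s *: w)))
    = (fun h => h^-1 *: ((f \o shift (v + s *: w)) (h *: w) - f (v + s *: w))).
  apply/funext => h /=; congr (_ *: (f _ - _)).
  by rewrite [_ *: 1]mulr1 scalerDl addrCA.
split; last by rewrite /derive E.
by rewrite /derivable E; exact: diff_derivable.
Qed.

(** Mean value theorem for [phi], which is [f] along the segment minus its tangent line and the
    quadratic majorant. Cauchy-Schwarz and the Lipschitz gradient make its derivative nonpositive,
    so no integral along the segment is formed. *)
Lemma smooth_bregman c f u v : smooth c f -> bregman f u v <= c / 2 * sqnorm (u - v).
Proof.
move=> [df lf]; set w := u - v.
pose phi (s : R) := f (v + s *: w) - (s * dot (grad f v) w + c / 2 * sqnorm w * s ^+ 2).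
pose dphi (s : R) := dot (grad f (v + s *: w)) w -
  (dot (grad f v) w + c * sqnorm w * s).
have dphiE (s : R) : is_derive s 1 phi (dphi s).
  have d1 := is_derive_line f v w s df.
  apply: is_deriveB.
  apply: is_derive_eq.
  by rewrite /GRing.scale /=; field.
have [s + phiE] : exists2 s, s \in `]0, 1[%R & phi 1 - phi 0 = dphi s * (1 - 0).
  apply: MVT => //; apply: derivable_within_continuous => t _.
  by have [] := dphiE t.
rewrite in_itv /= => /andP[s0 s1].
have h1 : dphi s <= 0.
  rewrite /dphi opprD addrA subr_le0 -dotBl.
  apply: le_trans (dot_le_enorm _ _) _.
  have := lf (v + s *: w) v; rewrite addrAC subrr add0r enormZ gtr0_norm// => h.
  apply: le_trans (ler_wpM2r (enorm_ge0 _) h) _.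
  by rewrite -sqr_enorm; nra.
have -> : bregman f u v = phi 1 - phi 0 + c / 2 * sqnorm w.
  rewrite /phi /bregman scale1r scale0r addr0 [v + w]addrC subrK -/w; ring.
by rewrite phiE subr0 mulr1 gerDr.
Qed.

Lemma convex_bregman_ge0 f u v : convex f -> differentiable f v -> 0 <= bregman f u v.
Proof.
move=> cf df; have sc0 : strongly_convex 0 f.
  rewrite /strongly_convex; have -> : (fun x => f x - 0 / 2 * sqnorm x) = f => //.
  by apply/funext => x; rewrite !mul0r subr0.
by have := strongly_convex_bregman 0 f u v sc0 df; rewrite !mul0r.
Qed.

(** Cocoercivity: a step of length [s] from [u] along [- g] lowers the nonnegative function
    [bregman f _ v] by at least [s (1 - c s / 2)] times [sqnorm g], and [s = c^-1] is the best
    choice. [smooth c] leaves the sign of [c] open: [c < 0] forces [u = v], and [c = 0] forces equal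
    gradients. *)
Lemma sqnorm_grad_gap_le c f u v : smooth c f ->
  (forall x y, 0 <= bregman f x y) ->
  sqnorm (grad f u - grad f v) <= 2 * c * bregman f u v.
Proof.
move=> [df lf] bf0; set g := grad f u - grad f v.
have low (s : R) : s * (1 - c * s / 2) * sqnorm g <= bregman f u v.
  have := smooth_bregman c f (u - s *: g) u (conj df lf).
  have := bf0 (u - s *: g) v.
  have ug : u - s *: g - u = - (s *: g) by rewrite addrAC subrr add0r.
  rewrite /bregman ug !dotBr dotNr sqnormN sqnormZ !dotZr.
  have : sqnorm g = dot (grad f u) g - dot (grad f v) g by rewrite -dotBl.
  by move=> ->; lra.
have lfuv := lf u v; rewrite -/g in lfuv.
have [c0|c0|c0] := ltgtP c 0.
- have e0 : enorm (u - v) = 0.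
    by apply/eqP; rewrite eq_le enorm_ge0 andbT; have := enorm_ge0 g; nra.
  have g0 : enorm g = 0.
    by apply/eqP; rewrite eq_le enorm_ge0 andbT; move: lfuv; rewrite e0 mulr0.
  have /sqnorm_eq0 uv0 : sqnorm (u - v) = 0 by rewrite -sqr_enorm e0 expr0n.
  rewrite -sqr_enorm g0 expr0n /= /bregman uv0 (subr0_eq uv0) subrr sub0r.
  by rewrite dot0r oppr0 mulr0.
- have := low c^-1; rewrite mulfV ?gt_eqF// => h.
  have : 2 * c * (c^-1 * (1 - 1 / 2) * sqnorm g) <= 2 * c * bregman f u v.
    by rewrite ler_pM2l// mulr_gt0.
  apply: le_trans; rewrite le_eqVlt; apply/orP; left; apply/eqP; field.
  by rewrite gt_eqF.
- rewrite c0 mulr0 mul0r; rewrite c0 mul0r in lfuv.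
  have g0 : enorm g = 0 by apply/eqP; rewrite eq_le enorm_ge0 andbT.
  by rewrite -sqr_enorm g0 expr0n.
Qed.

Lemma smooth_grad_continuous c (g : 'M[R]_(m, n) -> R) i j :
  smooth c g -> continuous (fun v => grad g v i j).
Proof.
move=> [_ lg] v.
have cn : c * enorm (w - v) @[w --> v] --> 0.
  have cs : sqnorm (w - v) @[w --> v] --> 0.
    have -> : 0 = \sum_k \sum_l (v k l - v k l) * (v k l - v k l).
      by rewrite big1// => k _; rewrite big1// => l _; rewrite subrr mulr0.
    rewrite /sqnorm /dot.
    apply: cvg_big => [||k _]; [exact: add_continuous|exact: nbhs_filter|].
    apply: cvg_big => [||l _]; [exact: add_continuous|exact: nbhs_filter|].
    have cl : (w - v) k l @[w --> v] --> v k l - v k l.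
      under eq_fun do rewrite !mxE.
      exact: (cvgB (@coord_continuous R m n k l v) (cvg_cst _)).
      exact: (cvgM cl cl).
  have ce : enorm (w - v) @[w --> v] --> Num.sqrt 0.
    exact: (cvg_comp _ _ cs (@sqrt_continuous R 0)).
  have cc : c * enorm (w - v) @[w --> v] --> c * Num.sqrt 0.
    exact: (cvgM (cvg_cst c) ce).
  by rewrite sqrtr0 mulr0 in cc.
have FF : Filter (nbhs v) by exact: nbhs_filter.
apply/cvgrPdist_le => e e0.
apply: filterS (cvgr_dist_le _ _ cn _ e0) => w; rewrite sub0r normrN => cw.
rewrite distrC; apply: le_trans (le_trans (lg w v) (le_trans (ler_norm _) cw)).
rewrite -(@ler_pXn2r _ 2) ?nnegrE ?enorm_ge0// sqr_enorm real_normK ?num_real//.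
rewrite -entryB; exact: sqr_entry_le.
Qed.

Lemma bregman_three_points f u x y :
  dot (grad f x - grad f y) (u - y) =
  bregman f y x + bregman f u y - bregman f u x.
Proof. by rewrite /bregman !dotBr !dotBl; ring. Qed.

End convex_smooth.

Lemma grad_total_obj {R : realType} {n d : nat} (f : 'I_n -> 'rV[R]_d -> R)
    (x : 'M[R]_(n, d)) :
  grad (total_obj f) x = \matrix_i grad (f i) (row i x).
Proof.
apply/matrixP => i j; rewrite !mxE /derive.
set F := (X in lim (X @ _) = _); set G := (X in _ = lim (X @ _)).
suff -> : F = G by [].
apply/funext => h; rewrite /F /G /=; congr (_ *: _).
rewrite /total_obj -sumrB (bigD1 i)//= big1 ?addr0.
  congr (f i _ - _); apply/matrixP => k l; rewrite ord1 !mxE eqxx.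
  by rewrite eqxx.
move=> k ki; rewrite [X in f k X](_ : _ = row k x) ?subrr//.
by apply/matrixP => k' l; rewrite !mxE (negbTE ki) mulr0 add0r.
Qed.

(** * Measurability and independence *)

Section caratheodory.
Context {d0} {T : measurableType d0} {R : realType} {m n : nat}.

(* Rounding down to the grid of step [1/(k+1)] makes the argument countably valued. *)
Let approx (k : nat) (q : 'M[int]_(m, n)) : 'M[R]_(m, n) :=
  \matrix_(i, j) ((q i j)%:~R / k.+1%:R).

Let code (k : nat) (v : 'M[R]_(m, n)) : 'M[int]_(m, n) :=
  \matrix_(i, j) Num.floor (k.+1%:R * v i j).

Let approx_cvg (v : 'M[R]_(m, n)) : approx k (code k v) @[k --> \oo] --> v.
Proof.
apply/cvg_ballP => e e0; near=> k; split => // i j.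
rewrite /ball /= !mxE.
have k0 : 0 < k.+1%:R :> R by rewrite ltr0n.
have /andP[fl fu] : (Num.floor (k.+1%:R * v i j))%:~R <= k.+1%:R * v i j <
    (Num.floor (k.+1%:R * v i j) + 1)%:~R by apply: real_floor_itv; exact: num_real.
rewrite intrD in fu; set z := (_%:~R : R) in fl fu *.
have -> : v i j - z / k.+1%:R = (k.+1%:R * v i j - z) / k.+1%:R.
  by field; rewrite gt_eqF// addrC natr1.
rewrite ger0_norm; last by rewrite divr_ge0 ?subr_ge0// ltW.
apply: (@le_lt_trans _ _ (k.+1%:R^-1)).
  by rewrite ler_pdivrMr// mulVf ?gt_eqF// lerBlDl ltW.
near: k; have := @near_infty_natSinv_lt R (PosNum e0); exact.
Unshelve. all: by end_near.
Qed.

(** On each grid cell the rounded argument is constant, so a preimage is a countable union, over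
    integer matrices [q], of a cell event for [X] intersected with an event for [h] at a fixed
    point. Continuity of [h s] then passes to the limit. *)
Lemma measurable_caratheodory (h : T -> 'M[R]_(m, n) -> R) (X : T -> 'M[R]_(m, n)) :
  (forall v, measurable_fun setT (h^~ v)) -> (forall s, continuous (h s)) ->
  (forall i j, measurable_fun setT (fun s => X s i j)) ->
  measurable_fun setT (fun s => h s (X s)).
Proof.
move=> mh ch mX.
apply: (measurable_fun_cvg (h := fun k s => h s (approx k (code k (X s))))); last first.
  by move=> s _; apply: continuous_cvg; [exact: ch|exact: approx_cvg].
move=> k _ B mB; rewrite setTI.
have -> : (fun s => h s (approx k (code k (X s)))) @^-1` B =
    \bigcup_(q : 'M[int]_(m, n)) (\bigcap_(ij in [set: 'I_m * 'I_n])
       ((fun s => X s ij.1 ij.2) @^-1`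
          [set` `[(q ij.1 ij.2)%:~R / k.+1%:R, ((q ij.1 ij.2) + 1)%:~R / k.+1%:R[]) `&`
     (h^~ (approx k q)) @^-1` B).
  have k0 : 0 < k.+1%:R :> R by rewrite ltr0n.
  apply/seteqP; split => s /=.
    move=> Bs; exists (code k (X s)) => //; split => //= -[i j] _ /=.
    rewrite in_itv /= mxE ler_pdivrMr// ltr_pdivlMr// ![_ * k.+1%:R]mulrC.
    by apply: real_floor_itv; exact: num_real.
  move=> [q _ [/= qX]]; suff -> : code k (X s) = q by [].
  apply/matrixP => i j; rewrite mxE; apply: floor_def.
  have := qX (i, j) I; rewrite /= in_itv /= ler_pdivrMr// ltr_pdivlMr//.
  by rewrite mulrC.
apply: countable_bigcupT_measurable; first exact: countableP.
move=> q; apply: measurableI; last by rewrite -[X in measurable X]setTI; exact: mh.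
apply: fin_bigcap_measurable; first exact: finite_finset.
by move=> ij _; rewrite -[X in measurable X]setTI; exact: mX.
Qed.

End caratheodory.

(** Differentiability allows the derivative to be computed along the sequence [1 / (k + 1)], a
    countable limit of measurable difference quotients. *)
Lemma measurable_grad {d0} {T : measurableType d0} {R : realType} {m n : nat}
    (h : T -> 'M[R]_(m, n) -> R) (x : 'M[R]_(m, n)) i j :
  (forall v, measurable_fun setT (h^~ v)) ->
  (forall s, differentiable (h s) x) ->
  measurable_fun setT (fun s => grad (h s) x i j).
Proof.
move=> mh dh.
pose t k : R := k.+1%:R^-1.
apply: (measurable_fun_cvg (h := fun k s =>
  (t k)^-1 * (h s (t k *: delta_mx i j + x) - h s x))).
  by move=> k; apply: measurable_funM => //; exact: measurable_funB.
move=> s _; rewrite mxE.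
have ds : (fun e => e^-1 *: ((h s \o shift x) (e *: delta_mx i j) - h s x)) @ 0^' -->
    'D_(delta_mx i j) (h s) x by exact: diff_derivable.
have t0 : t @ \oo --> 0^'.
  move=> A [e /= e0 He]; suff : \forall k \near \oo, A (t k) by [].
  near=> k; apply: He.
    rewrite /= sub0r normrN gtr0_norm ?invr_gt0 ?ltr0n//.
    by near: k; have := @near_infty_natSinv_lt R (PosNum e0); exact.
  by rewrite /t invr_eq0 pnatr_eq0.
exact: (cvg_comp _ _ t0 ds).
Unshelve. all: by end_near.
Qed.

Section independence.
Context {disp : measure_display} {Omega : measurableType disp} {R : realType}.
Variable P : probability Omega R.

Definition sigma_gen {I : Type} {disp'} {T : measurableType disp'}
    (X : I -> Omega -> T) (J : set I) : set (set Omega) :=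
  [set E | exists i A, [/\ J i, measurable A & E = X i @^-1` A]].

(** Unlike [sigma_gen], this family is closed under intersection, as the uniqueness theorem for
    measures demands. *)
Let cylinders {I : eqType} {disp'} {T : measurableType disp'}
    (X : I -> Omega -> T) (J : set I) : set (set Omega) :=
  [set E | exists (s : seq I) (A : I -> set T),
    [/\ uniq s, forall i, i \in s -> J i, forall i, measurable (A i) &
        E = \bigcap_(i in [set` s]) X i @^-1` A i]].

Context {I : choiceType} {disp'} {T : measurableType disp'} (X : I -> Omega -> T).
Hypothesis mX : forall i, measurable_fun setT (X i).
Hypothesis indX : independent_family P X.

Let mpre i A : measurable A -> measurable (X i @^-1` A).
Proof. by move=> mA; rewrite -[X in measurable X]setTI; exact: mX. Qed.

Let cylinders_measurable J : cylinders X J `<=` measurable.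
Proof.
move=> _ [s [A [_ _ mA ->]]]; apply: fin_bigcap_measurable.
  exact: finite_seq.
by move=> i _; exact: mpre.
Qed.

Let cylinders_setI J : setI_closed (cylinders X J).
Proof.
move=> _ _ [s [A [us Js mA ->]]] [t [B [ut Jt mB ->]]].
exists (undup (s ++ t)), (fun i => (if i \in s then A i else setT) `&`
                       (if i \in t then B i else setT)); split.
- exact: undup_uniq.
- by move=> i; rewrite mem_undup mem_cat => /orP[/Js|/Jt].
- by move=> i; apply: measurableI; case: ifP.
- apply/seteqP; split => x /=.
    move=> [xA xB] i _ /=; split.
      by case: ifP => // is_; exact: xA.
    by case: ifP => // it; exact: xB.
  move=> xAB; split => i /= ii.
    have := xAB i; rewrite /= mem_undup mem_cat ii => /(_ isT) [+ _].
    by [].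
  have := xAB i; rewrite /= mem_undup mem_cat ii orbT => /(_ isT) [_].
  by [].
Qed.

Let cylinders_setT J : cylinders X J setT.
Proof.
exists [::], (fun=> setT); split => //.
by apply/seteqP; split => x //= _ i.
Qed.

Let gen_cylinders J : <<s sigma_gen X J>> `<=` <<s cylinders X J>>.
Proof.
apply: sub_sigma_algebra2 => _ [i [A [Ji mA ->]]].
exists [:: i], (fun=> A); split => //.
  by move=> k; rewrite inE => /eqP ->.
apply/seteqP; split => x /= xA; first by move=> k; rewrite /= inE => /eqP ->.
by apply: (xA i) => /=; rewrite inE.
Qed.

Let indep_cylinders J1 J2 E1 E2 : J1 `&` J2 = set0 ->
  cylinders X J1 E1 -> cylinders X J2 E2 -> P (E1 `&` E2) = (P E1 * P E2)%E.
Proof.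
move=> J12 [s [A [us Js mA ->]]] [t [B [ut Jt mB ->]]].
have st i : i \in s -> i \in t -> False.
  move=> /Js J1i /Jt J2i; have : (J1 `&` J2) i by [].
  by rewrite J12.
(* Disjointness of the two index lists makes a single family [C] agree with [A] on [s] and with [B]
   on [t], so the product rule applies to [s ++ t]. *)
pose C i := if i \in s then A i else B i.
have mC i : measurable (C i) by rewrite /C; case: ifP.
have Es : \bigcap_(i in [set` s]) X i @^-1` A i = \big[setI/setT]_(i <- s) (X i @^-1` C i).
  rewrite -bigcap_seq; apply: eq_bigcapr => i /= is_.
  by rewrite /C is_.
have Et : \bigcap_(i in [set` t]) X i @^-1` B i = \big[setI/setT]_(i <- t) (X i @^-1` C i).
  rewrite -bigcap_seq; apply: eq_bigcapr => i /= it.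
  by rewrite /C; case: ifP => // is_; case: (st i is_ it).
have ust : uniq (s ++ t).
  rewrite cat_uniq us ut andbT /=; apply/hasPn => i it; apply/negP => is_.
  exact: (st i).
rewrite Es Et -big_cat (indX _ _ ust mC) big_cat /=.
by rewrite (indX _ _ us mC) (indX _ _ ut mC).
Qed.

(** With [E2] fixed, both sides are finite measures in the other event; they agree on a pi-system,
    hence on the sigma-algebra it generates. *)
Let extend J E2 (E1 : set Omega) : measurable E2 ->
  (forall E, cylinders X J E -> P (E `&` E2) = (P E * P E2)%E) ->
  <<s cylinders X J>> E1 -> P (E1 `&` E2) = (P E1 * P E2)%E.
Proof.
move=> mE2 H.
pose r : {nonneg R} := NngNum (fine_ge0 (measure_ge0 P E2)).
have rE : r%:num%:E = P E2 by rewrite /= fineK// fin_num_measure.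
move=> sE1.
suff : mrestr P mE2 E1 = mscale r P E1 by rewrite /mrestr /mscale rE muleC.
apply: (g_sigma_algebra_measure_unique (cylinders X J) _ (fun=> setT)) sE1.
- exact: cylinders_measurable.
- by move=> _; exact: cylinders_setT.
- by apply/seteqP; split => // x _; exists 0%N.
- exact: cylinders_setI.
- by move=> E /H HE; apply: etrans HE _; rewrite muleC -rE.
- move=> _; change (P (setT `&` E2) < +oo)%E; rewrite setTI.
  by rewrite -ge0_fin_numE ?fin_num_measure.
Qed.

(** [extend] is applied twice, one event at a time, with the roles exchanged in between. *)
Lemma independent_sigma J1 J2 E1 E2 : J1 `&` J2 = set0 ->
  <<s sigma_gen X J1>> E1 -> <<s sigma_gen X J2>> E2 ->
  P (E1 `&` E2) = (P E1 * P E2)%E.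
Proof.
move=> J12 /gen_cylinders sE1 /gen_cylinders sE2.
have m2 E : <<s cylinders X J2>> E -> measurable E.
  by apply: smallest_sub; [exact: sigma_algebra_measurable|exact: cylinders_measurable].
apply: (extend _ _ _ _ _ sE1) => [|E cE]; first exact: m2.
rewrite setIC muleC; apply: (extend _ _ _ _ _ sE2).
  exact: cylinders_measurable cE.
by move=> E' cE'; rewrite setIC muleC; exact: (indep_cylinders _ _ _ _ J12).
Qed.

Lemma sigma_gen_sub J : <<s sigma_gen X J>> `<=` measurable.
Proof.
apply: smallest_sub; first exact: sigma_algebra_measurable.
by move=> _ [i [A [_ mA ->]]]; exact: mpre.
Qed.

End independence.

(** * Integration over independent random elements *)

Section independent_integral.
Context {disp : measure_display} {Omega : measurableType disp} {R : realType}.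
Variable P : probability Omega R.
Context {d1 d2} {T1 : measurableType d1} {T2 : measurableType d2}.
Variables (X : {mfun Omega >-> T1}) (Y : {mfun Omega >-> T2}).
Hypothesis indXY : forall A B, measurable A -> measurable B ->
  P (X @^-1` A `&` Y @^-1` B) = (P (X @^-1` A) * P (Y @^-1` B))%E.

Let mXY : measurable_fun setT (fun s => (X s, Y s)).
Proof. exact/measurable_fun_pair. Qed.

Let XY : {mfun Omega >-> (T1 * T2)%type} :=
  HB.pack (fun s => (X s, Y s)) (isMeasurableFun.Build _ _ _ _ _ mXY).

Let joint_law A : measurable A ->
  (distribution P X \x distribution P Y)%E A = distribution P XY A.
Proof.
apply: product_measure_unique => B C mB mC.
by rewrite /distribution /pushforward -indXY.
Qed.

(** Freezing: the joint law is the product law, so by Tonelli a bound for every frozen value of [X]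
    integrates. It stands in for conditioning on [X], and nonnegativity of [F] covers infinite
    integrals. *)
Lemma independent_integral_le (F : T1 * T2 -> \bar R) (b : T1 -> \bar R) :
  measurable_fun setT F -> (forall z, (0 <= F z)%E) -> measurable_fun setT b ->
  (forall x, (\int[P]_s F (x, Y s) <= b x)%E) ->
  (\int[P]_s F (X s, Y s) <= \int[P]_s b (X s))%E.
Proof.
move=> mF F0 mb Fb.
have b0 x : (0 <= b x)%E by apply: le_trans (Fb x); exact: integral_ge0.
rewrite -[leRHS](ge0_integral_distribution X)//.
rewrite [leLHS](_ : _ = (\int[distribution P X]_x \int[distribution P Y]_y F (x, y))%E).
  apply: ge0_le_integral => //.
  - by move=> x _; exact: integral_ge0.
  - exact: measurable_fun_fubini_tonelli_F.
  - move=> x _; rewrite ge0_integral_distribution//; first exact: Fb.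
    by apply: measurableT_comp => //; exact: measurable_pair1.
transitivity (\int[distribution P XY]_z F z)%E.
  by rewrite ge0_integral_distribution.
transitivity (\int[distribution P X \x distribution P Y]_z F z)%E.
  by apply: eq_measure_integral => A mA _; exact/esym/joint_law.
by rewrite fubini_tonelli1.
Qed.

Lemma independent_fubini (F : T1 * T2 -> \bar R) :
  measurable_fun setT F -> P.-integrable setT (fun s => F (X s, Y s)) ->
  (\int[P]_s F (X s, Y s) =
   \int[distribution P X]_x \int[distribution P Y]_y F (x, y))%E.
Proof.
move=> mF iF.
transitivity (\int[distribution P XY]_z F z)%E.
  by rewrite integral_distribution.
transitivity (\int[distribution P X \x distribution P Y]_z F z)%E.
  by apply: eq_measure_integral => A mA _; exact/esym/joint_law.
have iXY : (distribution P XY).-integrable setT F.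
  by apply: integrable_pushforward => //; exact: mXY.
rewrite -integral12_prod_meas1//.
apply/integrableP; split => //; case/integrableP : iXY => _.
apply: le_lt_trans; rewrite le_eqVlt; apply/orP; left; apply/eqP.
by apply: eq_measure_integral => A mA _; exact: joint_law.
Qed.

End independent_integral.

Lemma independent_integralM {disp} {Omega : measurableType disp} {R : realType}
    (P : probability Omega R) (X Y : {mfun Omega >-> R}) :
  (forall A B, measurable A -> measurable B ->
    P (X @^-1` A `&` Y @^-1` B) = (P (X @^-1` A) * P (Y @^-1` B))%E) ->
  P.-integrable setT (EFin \o X) -> P.-integrable setT (EFin \o Y) ->
  P.-integrable setT (EFin \o (fun s => X s * Y s)) ->
  (\int[P]_s (X s * Y s) = (\int[P]_s X s) * \int[P]_s Y s)%R.
Proof.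
move=> ind iX iY iXY.
have iYd : (distribution P Y).-integrable setT (EFin \o id).
  by apply: integrable_pushforward => //; exact/measurable_EFinP.
have iXd : (distribution P X).-integrable setT (EFin \o id).
  by apply: integrable_pushforward => //; exact/measurable_EFinP.
have EY : (\int[distribution P Y]_y y%:E = (\int[P]_s Y s)%:E)%E.
  rewrite integral_distribution//.
  by rewrite /Rintegral fineK//; exact: integrable_fin_num.
have EX : (\int[distribution P X]_y y%:E = (\int[P]_s X s)%:E)%E.
  rewrite integral_distribution//.
  by rewrite /Rintegral fineK//; exact: integrable_fin_num.
rewrite {1}/Rintegral (independent_fubini _ _ _ ind (fun z => (z.1 * z.2)%:E))//; last first.
  by apply/measurable_EFinP; apply: measurable_funM.
under eq_integral do rewrite /=; under eq_integral => x _.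
  under eq_integral do rewrite EFinM.
  rewrite integralZl// EY.
  over.
by rewrite integralZr// EX -EFinM.
Qed.

(** * Second moments *)

Section Rintegral_quadratic.
Context {disp : measure_display} {Omega : measurableType disp} {R : realType}.
Variable P : probability Omega R.

Lemma Rintegral_cst_probability (c : R) : (\int[P]_s c)%R = c.
Proof.
rewrite Rintegral_cst//; transitivity (c * fine 1%E); last exact: mulr1.
by congr (_ * fine _); exact: probability_setT.
Qed.

Lemma integrable_sumr {I : Type} (r : seq I) (f : I -> Omega -> R) :
  (forall i, P.-integrable setT (EFin \o f i)) ->
  P.-integrable setT (EFin \o (fun s => \sum_(i <- r) f i s)).
Proof.
move=> fi; apply: (eq_integrable _ (fun s => (\sum_(i <- r) (EFin \o f i) s)%E)) => //.
  by move=> s _; rewrite /= sumEFin.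
exact: integrable_sum.
Qed.

Lemma Rintegral_sum {I : Type} (r : seq I) (f : I -> Omega -> R) :
  (forall i, P.-integrable setT (EFin \o f i)) ->
  (\int[P]_s (\sum_(i <- r) f i s) = \sum_(i <- r) \int[P]_s f i s)%R.
Proof.
move=> fi; elim: r => [|i r IH].
  by rewrite big_nil; under eq_Rintegral do rewrite big_nil; rewrite Rintegral_cst// mul0r.
rewrite big_cons -IH -RintegralD//; last exact: integrable_sumr.
by apply: eq_Rintegral => s _; rewrite big_cons.
Qed.

Lemma integrable_scale (a : R) (f : Omega -> R) :
  P.-integrable setT (EFin \o f) -> P.-integrable setT (EFin \o (fun s => a * f s)).
Proof.
move=> fi; apply: (eq_integrable _ (fun s => (a%:E * (EFin \o f) s)%E)) => //.
exact: integrableZl.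
Qed.

Lemma integrable_mul_sqr (f g : Omega -> R) :
  measurable_fun setT f -> measurable_fun setT g ->
  P.-integrable setT (EFin \o (fun s => f s ^+ 2)) ->
  P.-integrable setT (EFin \o (fun s => g s ^+ 2)) ->
  P.-integrable setT (EFin \o (fun s => f s * g s)).
Proof.
move=> mf mg f2 g2.
apply: (le_integrable measurableT _ _ (integrableD measurableT f2 g2)).
  by apply/measurable_EFinP; exact: measurable_funM.
move=> s _ /=; rewrite lee_fin [leRHS]ger0_norm ?addr_ge0 ?sqr_ge0//.
rewrite normrM -(real_normK (num_real (f s))) -(real_normK (num_real (g s))).
by have := sqr_ge0 (`|f s| - `|g s|); have := sqr_ge0 (`|f s| + `|g s|); nra.
Qed.

Lemma integrable_of_sqr (f : Omega -> R) : measurable_fun setT f ->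
  P.-integrable setT (EFin \o (fun s => f s ^+ 2)) ->
  P.-integrable setT (EFin \o f).
Proof.
move=> mf f2.
have := integrable_mul_sqr f (fun=> 1) mf (measurable_cst _) f2.
have -> : (fun s => f s * (fun=> 1) s) = f by apply/funext => s; rewrite mulr1.
apply; rewrite expr1n; exact: finite_measure_integrable_cst.
Qed.

Context {n d : nat}.

Lemma integrable_sqnorm_entry (Z : Omega -> 'M[R]_(n, d)) i j :
  (forall i j, measurable_fun setT (fun s => Z s i j)) ->
  P.-integrable setT (EFin \o (fun s => sqnorm (Z s))) ->
  P.-integrable setT (EFin \o (fun s => Z s i j ^+ 2)).
Proof.
move=> mZ; apply: le_integrable => //.
  by apply/measurable_EFinP; exact: measurable_funX.
move=> s _ /=; rewrite lee_fin !ger0_norm ?sqr_ge0 ?sqnorm_ge0//.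
exact: sqr_entry_le.
Qed.

Definition mean_mx (Z : Omega -> 'M[R]_(n, d)) : 'M[R]_(n, d) :=
  \matrix_(i, j) (\int[P]_s Z s i j)%R.

Context (A : 'M[R]_n) (Z : Omega -> 'M[R]_(n, d)).
Hypothesis mZ : forall i j, measurable_fun setT (fun s => Z s i j).
Hypothesis Z2 : P.-integrable setT (EFin \o (fun s => sqnorm (Z s))).

Let iZ2 i j := integrable_sqnorm_entry Z i j mZ Z2.

Let iZ i j k l : P.-integrable setT (EFin \o (fun s => Z s i j * Z s k l)).
Proof. by apply: integrable_mul_sqr. Qed.

Lemma integrable_dot (y : 'M[R]_(n, d)) :
  P.-integrable setT (EFin \o (fun s => dot y (Z s))).
Proof.
apply: integrable_sumr => i; apply: integrable_sumr => j; apply: integrable_scale.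
exact: integrable_of_sqr.
Qed.

Lemma Rintegral_dot (y : 'M[R]_(n, d)) :
  (\int[P]_s dot y (Z s))%R = dot y (mean_mx Z).
Proof.
have iZ1 i j : P.-integrable setT (EFin \o (fun s => Z s i j)).
  exact: integrable_of_sqr.
rewrite Rintegral_sum => [|i]; last first.
  by apply: integrable_sumr => j; apply: integrable_scale.
apply: eq_bigr => i _; rewrite Rintegral_sum => [|j]; last exact: integrable_scale.
by apply: eq_bigr => j _; rewrite RintegralZl// mxE.
Qed.

Let qnormE (B : 'M[R]_n) (x : 'M[R]_(n, d)) :
  qnorm B x = \sum_i \sum_k \sum_j B i k * (x i j * x k j).
Proof.
rewrite /qnorm /dot; apply: eq_bigr => i _; rewrite [RHS]exchange_big /=.
apply: eq_bigr => j _; rewrite mxE mulr_sumr; apply: eq_bigr => k _; ring.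
Qed.

Lemma integrable_qnorm : P.-integrable setT (EFin \o (fun s => qnorm A (Z s))).
Proof.
apply: (eq_integrable _
  (EFin \o (fun s => \sum_i \sum_k \sum_j A i k * (Z s i j * Z s k j)))) => //.
  by move=> s _; rewrite /= qnormE.
by do 3 (apply: integrable_sumr => ?); apply: integrable_scale; exact: iZ.
Qed.

(** Terms with [i != k] involve only the mean; terms with [i = k] carry the weight [a]. The
    covariance thus sees only the diagonal of [A], and this is the source of the variance
    reduction. *)
Lemma Rintegral_qnorm_uncorrelated a :
  (forall i, A i i = a) ->
  (forall i k j, i != k ->
    \int[P]_s (Z s i j * Z s k j) = (\int[P]_s Z s i j) * \int[P]_s Z s k j)%R ->
  (\int[P]_s qnorm A (Z s))%R =
  qnorm A (mean_mx Z) + a * ((\int[P]_s sqnorm (Z s))%R - sqnorm (mean_mx Z)).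
Proof.
move=> Aa unc.
have E1 : (\int[P]_s qnorm A (Z s))%R =
    \sum_i \sum_k \sum_j A i k * (\int[P]_s (Z s i j * Z s k j))%R.
  under eq_Rintegral do rewrite qnormE.
  rewrite Rintegral_sum => [|i]; last first.
    by do 2 (apply: integrable_sumr => ?); apply: integrable_scale; exact: iZ.
  apply: eq_bigr => i _; rewrite Rintegral_sum => [|k]; last first.
    by apply: integrable_sumr => ?; apply: integrable_scale; exact: iZ.
  apply: eq_bigr => k _; rewrite Rintegral_sum => [|j]; last first.
    by apply: integrable_scale; exact: iZ.
  by apply: eq_bigr => j _; rewrite RintegralZl//; exact: iZ.
have E2 : (\int[P]_s sqnorm (Z s))%R = \sum_i \sum_j (\int[P]_s (Z s i j * Z s i j))%R.
  rewrite Rintegral_sum => [|i]; last by apply: integrable_sumr => ?; exact: iZ.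
  by apply: eq_bigr => i _; rewrite Rintegral_sum => [|j]; last exact: iZ.
rewrite E1 E2 qnormE /sqnorm /dot -sumrB mulr_sumr -big_split /=.
apply: eq_bigr => i _; rewrite -sumrB mulr_sumr.
rewrite (bigD1 i)//= [X in _ = X + _](bigD1 i)//= Aa.
rewrite addrAC -big_split /=; congr (_ + _).
  apply: eq_bigr => j _; rewrite !mxE -!expr2; ring.
apply: eq_bigr => k ki; apply: eq_bigr => j _.
by rewrite unc ?mxE// eq_sym.
Qed.

End Rintegral_quadratic.

(** * Descent *)

Section gossip_spectrum.
Context {R : realType} {n : nat} (W : 'M[R]_n) (gamma omega : R) (l : 'I_n -> R).
Hypotheses (Ws : W^T = W) (Wds : doubly_stochastic W) (hl : eigenvalues_of W l).
Hypothesis hgamma : 0 <= gamma < 1.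

Lemma gossip_diagonalization : exists Q : 'M[R]_n,
  [/\ Q^T *m Q = 1%:M, W = spectral Q l & forall i, `|l i| <= 1].
Proof.
have [Q [Q1 WE]] := symmetric_diagonalization _ _ _ Ws hl.
(* [Q^T *m e] is an eigenvector for [l i], nonzero because [Q] sends it back to [e]. *)
exists Q; split => // i; pose e : 'cV[R]_n := delta_mx i 0.
have Qe : Q *m (Q^T *m e) = e by rewrite mulmxA (mulmx1C Q1) mul1mx.
apply: (@stochastic_eigenvalue _ _ W (Q^T *m e)) => //.
  rewrite [in LHS]WE -!mulmxA Qe scalemxAr; congr (_ *m _).
  apply/matrixP => k j; rewrite mul_diag_mx !mxE.
  by case: eqVneq => [->|_]; rewrite ?mulr0.
apply/eqP => e0; have := congr1 (fun v : 'cV_n => v i 0) Qe.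
by rewrite e0 mulmx0 !mxE !eqxx => /esym/eqP; rewrite oner_eq0.
Qed.

Definition lyapunov_mx : 'M[R]_n :=
  neighborhood W gamma + omega *: laplacian (neighborhood W gamma).

Lemma lyapunov_qnorm d (y : 'M[R]_(n, d)) :
  lyapunov W gamma omega y = qnorm lyapunov_mx y.
Proof. by rewrite /lyapunov_mx qnorm_opD qnorm_opZ. Qed.

Hypothesis homega : 0 <= omega <= 1.

Let m i := neighborhood_eigenvalue gamma (l i).
Let a i := m i + omega * (1 - m i).

Lemma lyapunov_mx_spectral (Q : 'M[R]_n) : Q^T *m Q = 1%:M -> W = spectral Q l ->
  (forall i, `|l i| <= 1) ->
  lyapunov_mx = spectral Q (fun i =>
    neighborhood_eigenvalue gamma (l i)
    + omega * (1 - neighborhood_eigenvalue gamma (l i))).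
Proof.
move=> Q1 WE l1; rewrite /lyapunov_mx /laplacian.
rewrite (neighborhood_spectral _ _ _ _ Q1 WE l1 hgamma) -(spectral1 Q1).
by rewrite spectralB spectralZ spectralD.
Qed.

Let a_itv i : `|l i| <= 1 -> 0 <= a i <= 1.
Proof.
move=> l1; have /andP[m0 mw] := neighborhood_eigenvalue_itv _ _ hgamma l1.
have [/andP[_ w1] _] := sqr_eigenvalue_lt1 _ _ hgamma l1.
have m1 := le_trans mw w1; move: homega => /andP[om0 om1].
rewrite /a /m; apply/andP; split; nra.
Qed.

Lemma lyapunov_mx_sym : lyapunov_mx^T = lyapunov_mx.
Proof.
have [Q [Q1 WE l1]] := gossip_diagonalization.
by rewrite (lyapunov_mx_spectral _ Q1 WE l1) spectral_tr.
Qed.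

Lemma lyapunov_mx_ge0 d (y : 'M[R]_(n, d)) : 0 <= qnorm lyapunov_mx y.
Proof.
have [Q [Q1 WE l1]] := gossip_diagonalization.
rewrite (lyapunov_mx_spectral _ Q1 WE l1) (qnorm_spectral Q1).
apply: sumr_ge0 => i _; rewrite mulr_ge0 ?sqnorm_ge0//.
by have /andP[] := a_itv i (l1 i).
Qed.

Lemma lyapunov_mx_le d (y : 'M[R]_(n, d)) : qnorm lyapunov_mx y <= sqnorm y.
Proof.
have [Q [Q1 WE l1]] := gossip_diagonalization.
rewrite (lyapunov_mx_spectral _ Q1 WE l1) (qnorm_spectral Q1) (sqnorm_spectral Q1).
apply: ler_sum => i _; rewrite ler_piMl ?sqnorm_ge0//.
by have /andP[] := a_itv i (l1 i).
Qed.

Lemma lyapunov_mx_diag i :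
  (forall i j, neighborhood W gamma i i = neighborhood W gamma j j) ->
  lyapunov_mx i i = (1 - omega) * (eff_neighbors l gamma)^-1 + omega.
Proof.
move=> hM; have [Q [Q1 WE l1]] := gossip_diagonalization.
rewrite (eff_neighborsV _ _ _ _ i Q1 WE l1 hgamma hM).
rewrite /lyapunov_mx /laplacian; move: (neighborhood W gamma) => M.
by rewrite !mxE eqxx mulr1n; ring.
Qed.

Lemma eff_neighborsV_ge0 (i0 : 'I_n) :
  (forall i j, neighborhood W gamma i i = neighborhood W gamma j j) ->
  0 <= (eff_neighbors l gamma)^-1.
Proof.
move=> hM; have [Q [Q1 WE l1]] := gossip_diagonalization.
rewrite (eff_neighborsV _ _ _ _ i0 Q1 WE l1 hgamma hM).
rewrite (neighborhood_spectral _ _ _ _ Q1 WE l1 hgamma) spectralE.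
apply: sumr_ge0 => k _; rewrite mulr_ge0 -?expr2 ?sqr_ge0//.
by have /andP[] := neighborhood_eigenvalue_itv _ _ hgamma (l1 k).
Qed.

(** All terms are diagonal in the basis [Q]; the claim is the sum of [eigenvalue_contraction] over
    the eigenvalues, weighted by the squared norms of the rows of [Q *m y]. *)
Lemma gossip_contraction beta p q d (y : 'M[R]_(n, d)) : 0 < beta ->
  loewner_le (laplacian (neighborhood W gamma)) (beta^-1 *: (laplacian W *m W)) ->
  0 <= q <= p -> p <= beta * omega ->
  qnorm lyapunov_mx (W *m y) + p * sqnorm (y - lyapunov_mx *m (W *m y))
    - q / 2 * sqnorm y - q * sqnorm (lyapunov_mx *m (W *m y))
  <= (1 - q) * qnorm lyapunov_mx y.
Proof.
move=> b0 hb qp pbo.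
have [Q [Q1 WE l1]] := gossip_diagonalization.
have AE := lyapunov_mx_spectral _ Q1 WE l1.
have ME := neighborhood_spectral _ _ _ _ Q1 WE l1 hgamma.
have hbi i : beta * (1 - m i) <= (1 - l i) * l i.
  move: hb; rewrite /loewner_le /laplacian ME WE -(spectral1 Q1).
  rewrite !spectralB (spectralM Q1) spectralZ spectralB => /(psdmx_spectral Q1 _ i).
  by rewrite subr_ge0 -ler_pdivlMl.
rewrite /qnorm AE WE.
set a' := (fun i => _ + _).
have BE : spectral Q a' *m (spectral Q l *m y) = spectral Q (fun i => a' i * l i) *m y.
  by rewrite mulmxA (spectralM Q1).
rewrite BE.
have -> : y - spectral Q (fun i => a' i * l i) *m y =
    spectral Q (fun i => 1 - a' i * l i) *m y.
  by rewrite -[X in X - _]mul1mx -mulmxBl -(spectral1 Q1) spectralB.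
rewrite -/(qnorm _ y) (qnorm_spectral Q1) {1 2}/sqnorm !(dot_spectral Q1).
rewrite -/(sqnorm y) (sqnorm_spectral Q1) /sqnorm (dot_spectral Q1).
rewrite !mulr_sumr -big_split /= -!sumrB; apply: ler_sum => i _.
rewrite -/(sqnorm _); set c := sqnorm _.
have := eigenvalue_contraction (l i) (m i) beta omega p q (l1 i)
  (neighborhood_eigenvalue_itv _ _ hgamma (l1 i)) b0 homega (hbi i) qp pbo (a' i) erefl.
have : 0 <= c by exact: sqnorm_ge0.
move=> c0 /(ler_wpM2r c0) => /le_trans; set a1 := a' i; set w := l i => h.
have -> : (1 - q) * (a1 * c) = (1 - q) * a1 * c by rewrite mulrA.
by apply: le_trans (h _ (lexx _)); rewrite le_eqVlt; apply/orP; left; apply/eqP; field.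
Qed.

End gossip_spectrum.

Section deterministic_descent.
Context {R : realType} {n d : nat} (W : 'M[R]_n) (gamma omega : R) (l : 'I_n -> R).
Hypotheses (Ws : W^T = W) (Wds : doubly_stochastic W) (hl : eigenvalues_of W l).
Hypotheses (hgamma : 0 <= gamma < 1) (homega : 0 <= omega <= 1).
Context (f : 'I_n -> 'rV[R]_d -> R) (mu L beta eta : R).
Hypotheses (mu0 : 0 <= mu) (beta0 : 0 < beta) (eta0 : 0 < eta).
Hypotheses (fmu : forall i, strongly_convex mu (f i)) (fL : forall i, smooth L (f i)).
Hypothesis hbeta :
  loewner_le (laplacian (neighborhood W gamma)) (beta^-1 *: (laplacian W *m W)).
Hypothesis etaL : eta * L <= beta * omega.

Let A := lyapunov_mx W gamma omega.

(** The added [eta * \sum_i _] is the half of the Bregman gain reserved for the noise. *)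
Lemma total_descent (x z : 'M[R]_(n, d)) :
  qnorm A (W *m (x - z))
    - 2 * eta * dot (A *m (W *m (x - z))) (grad (total_obj f) x - grad (total_obj f) z)
    + eta * \sum_i bregman (f i) (row i z) (row i x)
  <= (1 - eta * mu) * qnorm A (x - z).
Proof.
set y := x - z; set By := A *m (W *m y); set D := \sum_i _.
have df i v : differentiable (f i) v by have [+ _] := fL i.
have [y0|y_neq0] := eqVneq (sqnorm y) 0.
  have Dx : D = 0.
    apply: big1 => i _; have xz : x = z by apply: subr0_eq; exact: sqnorm_eq0.
    by rewrite /bregman xz !subrr dot0r subr0.
  rewrite Dx /By (sqnorm_eq0 _ y0) !mulmx0 mulr0 addr0.
  by rewrite /qnorm !dot0l !mulr0 subr0.
(* Comparing the strong convexity and smoothness bounds at a nonzero row of [y] gives [mu <= L];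
   this is why [y = 0] was set apart. *)
have muL : mu <= L.
  have [i yi0] : exists i, sqnorm (row i y) != 0.
    apply/existsP; apply: contraNT y_neq0; rewrite negb_exists => /forallP y0.
    by rewrite sqnorm_rows big1// => i _; apply/eqP; rewrite -[_ == _]negbK.
  have yi : 0 < sqnorm (row i y) by rewrite lt_neqAle eq_sym yi0 sqnorm_ge0.
  have := le_trans (strongly_convex_bregman mu (f i) (row i y) 0 (fmu i) (df i _))
     (smooth_bregman L (f i) (row i y) 0 (fL i)).
  rewrite subr0 ler_pM2r// ler_pM2r//.
have qp : 0 <= eta * mu <= eta * L.
  by apply/andP; split; [apply: mulr_ge0 => //; exact: ltW|rewrite ler_pM2l].
apply: le_trans (gossip_contraction W gamma omega l Ws Wds hl hgamma homega
  _ _ _ _ y beta0 hbeta qp etaL).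
rewrite -/A -/By.
have rows : dot By (grad (total_obj f) x - grad (total_obj f) z) =
    \sum_i (bregman (f i) (row i z) (row i x)
      + bregman (f i) (row i z + row i By) (row i z)
      - bregman (f i) (row i z + row i By) (row i x)).
  rewrite dot_rows; apply: eq_bigr => i _; rewrite -bregman_three_points.
  rewrite !grad_total_obj linearB /= !rowK dotC [row i z + _]addrC addrK //.
have HD : mu / 2 * sqnorm y <= D.
  rewrite sqnorm_rows mulr_sumr; apply: ler_sum => i _.
  rewrite -sqnormN -linearN /= opprB linearB /=.
  exact: strongly_convex_bregman.
have H1 : mu / 2 * sqnorm By <= \sum_i bregman (f i) (row i z + row i By) (row i z).
  rewrite sqnorm_rows mulr_sumr; apply: ler_sum => i _.
  have -> : row i By = row i z + row i By - row i z by rewrite [row i z + _]addrC addrK.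
  rewrite [row i z + (_ - _)]addrCA subrr addr0; exact: strongly_convex_bregman.
have H2 : \sum_i bregman (f i) (row i z + row i By) (row i x) <= L / 2 * sqnorm (y - By).
  rewrite (sqnorm_rows (y - By)) mulr_sumr; apply: ler_sum => i _.
  rewrite -sqnormN -linearN /= opprB /y opprB addrCA addrC linearD linearB /= -addrA.
  have -> : row i By + (- row i x + row i z) = row i z + row i By - row i x.
    by rewrite addrA addrC addrA.
  exact: smooth_bregman.
rewrite rows sumrB big_split /= -/D.
move: HD H1 H2; set b1 := \sum_i _; set b2 := \sum_i _ => HD H1 H2.
have := ler_wpM2l (ltW eta0) HD; have := ler_wpM2l (ltW eta0) H1.
have := ler_wpM2l (ltW eta0) H2; nra.
Qed.

End deterministic_descent.

(** * Measurability of stochastic gradients at random points *)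

Section measurable_stochastic_gradient.
Context {R : realType} {n d : nat} {dT} {T : measurableType dT}.

Lemma measurable_qnorm (A : 'M[R]_n) (Z : T -> 'M[R]_(n, d)) :
  (forall i j, measurable_fun setT (fun s => Z s i j)) ->
  measurable_fun setT (fun s => qnorm A (Z s)).
Proof.
move=> mZ; rewrite /qnorm /dot; do 2 apply: measurable_sum => ?.
apply: measurable_funM => //.
have -> i j : (fun s => (A *m Z s) i j) = (fun s => \sum_k A i k * Z s k j).
  by apply/funext => s; rewrite mxE.
by apply: measurable_sum => k; exact: measurable_funM.
Qed.

Lemma measurable_sqnorm (Z : T -> 'M[R]_(n, d)) :
  (forall i j, measurable_fun setT (fun s => Z s i j)) ->
  measurable_fun setT (fun s => sqnorm (Z s)).
Proof.
move=> mZ; under eq_fun do rewrite -qnorm1.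
exact: measurable_qnorm.
Qed.

Context {dXi} {Xi : measurableType dXi} (fs : Xi -> 'rV[R]_d -> R) (zetas : Xi -> R).
Hypothesis mfs : forall x, measurable_fun setT (fun z => fs z x).
Hypothesis sfs : forall z, smooth (zetas z) (fs z).

Lemma stoch_gradE (z : 'I_n -> Xi) (x : 'M[R]_(n, d)) i j :
  stoch_grad fs z x i j = grad (fs (z i)) (row i x) ord0 j.
Proof. by rewrite mxE. Qed.

Lemma measurable_stoch_grad (xi : 'I_n -> T -> Xi) (X : T -> 'M[R]_(n, d)) i j :
  (forall i, measurable_fun setT (xi i)) ->
  (forall i j, measurable_fun setT (fun s => X s i j)) ->
  measurable_fun setT (fun s => stoch_grad fs (xi^~ s) (X s) i j).
Proof.
move=> mxi mX.
under eq_fun do rewrite stoch_gradE.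
apply: (measurable_caratheodory (fun s v => grad (fs (xi i s)) v ord0 j) (fun s => row i (X s))).
- move=> v; apply: measurable_grad => [w|s].
    by apply: (measurableT_comp (mfs w)).
  by have [] := sfs (xi i s).
- by move=> s; exact: smooth_grad_continuous (sfs (xi i s)).
- by move=> k l; under eq_fun do rewrite mxE; exact: mX.
Qed.

End measurable_stochastic_gradient.

(** * Second moment of one stochastic step *)

Section noise.
Context {disp : measure_display} {Omega : measurableType disp} {R : realType}.
Variable P : probability Omega R.
Context {n d : nat} {dXi} {Xi : measurableType dXi}.
Context (xi : 'I_n -> {mfun Omega >-> Xi}).
Hypothesis indxi : forall i k (B C : set Xi), i != k -> measurable B -> measurable C ->
  P (xi i @^-1` B `&` xi k @^-1` C) = (P (xi i @^-1` B) * P (xi k @^-1` C))%E.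
Context (A : 'M[R]_n) (a : R).
Hypothesis Aa : forall i, A i i = a.

(** Row [i] is a measurable function of the sample of node [i] alone; independence across nodes
    thereby passes to the rows. *)
Definition samplewise (Z : Omega -> 'M[R]_(n, d)) : Prop :=
  exists phi : 'I_n -> 'I_d -> Xi -> R,
    (forall i j, measurable_fun setT (phi i j)) /\
    (forall s i j, Z s i j = phi i j (xi i s)).

Lemma samplewise_measurable Z i j :
  samplewise Z -> measurable_fun setT (fun s => Z s i j).
Proof.
move=> [phi [mphi Zphi]]; under eq_fun do rewrite Zphi.
exact: measurableT_comp.
Qed.

Lemma Rintegral_qnorm_samplewise Z : samplewise Z ->
  P.-integrable setT (EFin \o (fun s => sqnorm (Z s))) ->
  (\int[P]_s qnorm A (Z s))%R =
  qnorm A (mean_mx P Z) + a * ((\int[P]_s sqnorm (Z s))%R - sqnorm (mean_mx P Z)).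
Proof.
move=> sZ Z2; have mZ i j := samplewise_measurable Z i j sZ.
apply: Rintegral_qnorm_uncorrelated => // i k j ik.
have [phi [mphi Zphi]] := sZ.
have Z2' i' : P.-integrable setT (EFin \o (fun s => Z s i' j ^+ 2)).
  exact: integrable_sqnorm_entry.
pose X (i' : 'I_n) : {mfun Omega >-> R} :=
  HB.pack (fun s => Z s i' j) (isMeasurableFun.Build _ _ _ _ _ (mZ i' j)).
apply: (independent_integralM P (X i) (X k)).
- move=> B C mB mC.
  have E i' (D : set R) : X i' @^-1` D = xi i' @^-1` (phi i' j @^-1` D).
    by apply/seteqP; split => s /=; rewrite Zphi.
  rewrite !E indxi//.
  + by rewrite -[Y in measurable Y]setTI; exact: mphi.
  + by rewrite -[Y in measurable Y]setTI; exact: mphi.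
- exact: (integrable_of_sqr P (fun s => Z s i j) (mZ i j) (Z2' i)).
- exact: (integrable_of_sqr P (fun s => Z s k j) (mZ k j) (Z2' k)).
- exact: (integrable_mul_sqr P _ _ (mZ i j) (mZ k j) (Z2' i) (Z2' k)).
Qed.

Hypotheses (As : A^T = A) (A0 : forall y : 'M[R]_(n, d), 0 <= qnorm A y).
Hypotheses (A1 : forall y : 'M[R]_(n, d), qnorm A y <= sqnorm y) (a0 : 0 <= a).

(** [U] will be the gradient gap and [V] the noise at the fixed point. Nonnegativity at [U - V]
    bounds the form at [U + V] by twice the sum of the forms, whence the factor 2 in [sigma_M^2]. *)
Lemma qnorm_step_le (v U V : 'M[R]_(n, d)) eta :
  qnorm A (v - eta *: (U + V)) <=
  qnorm A v - 2 * eta * dot (A *m v) U - 2 * eta * dot (A *m v) V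
  + 2 * eta ^+ 2 * qnorm A U + 2 * eta ^+ 2 * qnorm A V.
Proof.
rewrite -scaleNr qnormD// qnormZ dotZr dotDr sqrrN.
have UV : qnorm A (U + V) <= 2 * qnorm A U + 2 * qnorm A V.
  have := A0 (U - V); rewrite !qnormD// dotNr.
  have -> : qnorm A (- V) = qnorm A V by rewrite -scaleN1r qnormZ sqrrN expr1n mul1r.
  by move: (dot _ _) => c; lra.
have := ler_wpM2l (sqr_ge0 eta) UV; lra.
Qed.

(** [V] is centered, so its cross term vanishes and only [a] times its second moment remains. For
    [U] the form at the mean is bounded by [sqnorm], and the negative term in the mean is
    discarded. *)
Lemma integral_step_le (v : 'M[R]_(n, d)) (U V : Omega -> 'M[R]_(n, d)) eta :
  samplewise U -> samplewise V ->
  P.-integrable setT (EFin \o (fun s => sqnorm (U s))) ->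
  P.-integrable setT (EFin \o (fun s => sqnorm (V s))) ->
  mean_mx P V = 0 ->
  (\int[P]_s (qnorm A (v - eta *: (U s + V s)))%:E <=
   (qnorm A v - 2 * eta * dot (A *m v) (mean_mx P U)
    + 2 * eta ^+ 2 * (sqnorm (mean_mx P U) + a * (\int[P]_s sqnorm (U s))%R)
    + eta ^+ 2 * (2 * a * (\int[P]_s sqnorm (V s))%R))%:E)%E.
Proof.
move=> sU sV U2 V2 V0.
have mU i j := samplewise_measurable U i j sU.
have mV i j := samplewise_measurable V i j sV.
pose b1 s := dot (A *m v) (U s); pose b2 s := dot (A *m v) (V s).
pose b3 s := qnorm A (U s); pose b4 s := qnorm A (V s).
have i1 : P.-integrable setT (EFin \o b1) by exact: integrable_dot.
have i2 : P.-integrable setT (EFin \o b2) by exact: integrable_dot.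
have i3 : P.-integrable setT (EFin \o b3) by exact: integrable_qnorm.
have i4 : P.-integrable setT (EFin \o b4) by exact: integrable_qnorm.
pose g s := qnorm A v + ((- (2 * eta)) * b1 s + ((- (2 * eta)) * b2 s +
   (2 * eta ^+ 2 * b3 s + 2 * eta ^+ 2 * b4 s))).
have j4 := integrable_scale P (2 * eta ^+ 2) _ i4.
have j3 := integrable_scale P (2 * eta ^+ 2) _ i3.
have j34 : P.-integrable setT (EFin \o (fun s => 2 * eta ^+ 2 * b3 s + 2 * eta ^+ 2 * b4 s)).
  exact: (integrableD measurableT j3 j4).
have j2 := integrable_scale P (- (2 * eta)) _ i2.
have j1 := integrable_scale P (- (2 * eta)) _ i1.
have j234 : P.-integrable setT (EFin \o (fun s => (- (2 * eta)) * b2 s +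
   (2 * eta ^+ 2 * b3 s + 2 * eta ^+ 2 * b4 s))).
  exact: (integrableD measurableT j2 j34).
have j1234 : P.-integrable setT (EFin \o (fun s => (- (2 * eta)) * b1 s +
   ((- (2 * eta)) * b2 s + (2 * eta ^+ 2 * b3 s + 2 * eta ^+ 2 * b4 s)))).
  exact: (integrableD measurableT j1 j234).
have jc : P.-integrable setT (EFin \o (fun=> qnorm A v)).
  exact: finite_measure_integrable_cst.
have ig : P.-integrable setT (EFin \o g) by exact: (integrableD measurableT jc j1234).
apply: (@le_trans _ _ (\int[P]_s (g s)%:E)%E).
  apply: ge0_le_integral => //.
  - by move=> s _; rewrite lee_fin.
  - apply/measurable_EFinP; apply: measurable_qnorm => i j.
    under eq_fun do rewrite entryB [in X in _ - X]mxE [in X in _ * X]mxE.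
    by apply: measurable_funB => //; apply: measurable_funM => //; exact: measurable_funD.
  - exact: measurable_int ig.
  - move=> s _; rewrite lee_fin; apply: le_trans (qnorm_step_le _ _ _ _) _.
    by rewrite /g /b1 /b2 /b3 /b4; lra.
rewrite -[leLHS]fineK ?lee_fin; last exact: integrable_fin_num.
rewrite -/(Rintegral P setT g) /g RintegralD// RintegralD// RintegralD// RintegralD//.
have Ec : (\int[P]_s qnorm A v)%R = qnorm A v.
  exact: Rintegral_cst_probability.
rewrite !RintegralZl// Ec.
rewrite /b1 /b2 /b3 /b4 !Rintegral_dot// !Rintegral_qnorm_samplewise// V0.
rewrite dot0r /qnorm /sqnorm !dot0l -/(sqnorm (mean_mx P U)) -/(qnorm A (mean_mx P U)).
have h1 := ler_wpM2l (sqr_ge0 eta) (A1 (mean_mx P U)).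
have h2 := mulr_ge0 (sqr_ge0 eta) (mulr_ge0 a0 (sqnorm_ge0 (mean_mx P U))).
by set e2 := eta ^+ 2 in h1 h2 *; lra.
Qed.

End noise.

Section expected_descent.
Context {disp : measure_display} {Omega : measurableType disp} {R : realType}.
Variable P : probability Omega R.
Context {n d : nat} {dXi} {Xi : measurableType dXi}.
Context (xi : 'I_n -> {mfun Omega >-> Xi}).
Hypothesis indxi : forall i k (B C : set Xi), i != k -> measurable B -> measurable C ->
  P (xi i @^-1` B `&` xi k @^-1` C) = (P (xi i @^-1` B) * P (xi k @^-1` C))%E.
Context (f : 'I_n -> 'rV[R]_d -> R) (fs : Xi -> 'rV[R]_d -> R) (zetas : Xi -> R).
Hypothesis mfs : forall x, measurable_fun setT (fun z => fs z x).
Hypothesis mzetas : measurable_fun setT zetas.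
Hypotheses (cfs : forall z, convex (fs z)) (sfs : forall z, smooth (zetas z) (fs z)).
Context (zeta : R).
Hypothesis hzeta : forall (i : 'I_n) (u v : 'rV[R]_d),
  ('E_P[fun s => (zetas (xi i s) * bregman (fs (xi i s)) u v)%R]
     <= (zeta * bregman (f i) u v)%:E)%E.
Hypothesis igrad : forall (i : 'I_n) (x : 'rV[R]_d) (j : 'I_d),
  P.-integrable setT (fun s => (grad (fs (xi i s)) x ord0 j)%:E).
Hypothesis hgrad : forall (i : 'I_n) (x : 'rV[R]_d) (j : 'I_d),
  ('E_P[fun s => grad (fs (xi i s)) x ord0 j] = (grad (f i) x ord0 j)%:E)%E.

Let G s := stoch_grad fs (fun i => xi i s).

Let mgrad (x : 'rV[R]_d) j : measurable_fun setT (fun z => grad (fs z) x ord0 j).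
Proof. by apply: measurable_grad => // z; have [] := sfs z. Qed.

Let mG (x : 'M[R]_(n, d)) i j : measurable_fun setT (fun s => G s x i j).
Proof. exact: (measurable_stoch_grad fs zetas mfs sfs (fun i s => xi i s) (fun=> x)). Qed.

Let mbregman u v : measurable_fun setT (fun z => zetas z * bregman (fs z) u v).
Proof.
apply: measurable_funM => //; apply: measurable_funB.
  exact: measurable_funB.
do 2 apply: measurable_sum => ?; apply: measurable_funM => //.
by rewrite ord1.
Qed.

(** Cocoercivity is applied to each sampled function with its own constant, and [hzeta] averages the
    product. The gap is even, so the divergence can be oriented as in the three-point identity. *)
Lemma expected_grad_gap_le (x z : 'M[R]_(n, d)) :
  (\int[P]_s (sqnorm (G s x - G s z))%:E <=
   (2 * (zeta * \sum_i bregman (f i) (row i z) (row i x)))%:E)%E.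
Proof.
under eq_integral do rewrite sqnorm_rows -sumEFin.
rewrite ge0_integral_sum//; last 2 first.
- move=> i; apply/measurable_EFinP; apply: measurable_sqnorm => k l.
  by under eq_fun do rewrite mxE entryB; apply: measurable_funB; exact: mG.
- by move=> i s _; rewrite lee_fin sqnorm_ge0.
rewrite !mulr_sumr -sumEFin; apply: lee_sum => i _.
have le_breg s : sqnorm (row i (G s x - G s z)) <=
    2 * (zetas (xi i s) * bregman (fs (xi i s)) (row i z) (row i x)).
  rewrite linearB /= /G !rowK -sqnormN opprB mulrA.
  apply: sqnorm_grad_gap_le => // u v; apply: convex_bregman_ge0 => //.
  by have [] := sfs (xi i s).
apply: (@le_trans _ _ (\int[P]_s
    (2 * (zetas (xi i s) * bregman (fs (xi i s)) (row i z) (row i x)))%:E)%E).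
  apply: ge0_le_integral => //.
  - by move=> s _; rewrite lee_fin sqnorm_ge0.
  - apply/measurable_EFinP; apply: measurable_sqnorm => k l.
    by under eq_fun do rewrite mxE entryB; apply: measurable_funB; exact: mG.
  - apply/measurable_EFinP; apply: measurable_funM => //.
    exact: (measurableT_comp (mbregman (row i z) (row i x))).
  - by move=> s _; rewrite lee_fin; exact: le_breg.
under eq_integral do rewrite EFinM.
rewrite ge0_integralZl//; last 2 first.
- by apply/measurable_EFinP; exact: (measurableT_comp (mbregman (row i z) (row i x))).
- move=> s _; rewrite lee_fin -(@pmulr_rge0 _ 2)//.
  exact: le_trans (sqnorm_ge0 _) (le_breg s).
rewrite [leRHS]EFinM lee_pmul2l//.
by have := hzeta i (row i z) (row i x); rewrite unlock.
Qed.

Let sampleG (x : 'M[R]_(n, d)) (c : 'M[R]_(n, d)) : samplewise xi (fun s => G s x - c).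
Proof.
exists (fun i j z => grad (fs z) (row i x) ord0 j - c i j); split.
  by move=> i j; exact: measurable_funB.
by move=> s i j; rewrite entryB stoch_gradE.
Qed.

Let sampleGG (x z : 'M[R]_(n, d)) : samplewise xi (fun s => G s x - G s z).
Proof.
exists (fun i j w => grad (fs w) (row i x) ord0 j - grad (fs w) (row i z) ord0 j); split.
  by move=> i j; exact: measurable_funB.
by move=> s i j; rewrite entryB !stoch_gradE.
Qed.

Let iG (x : 'M[R]_(n, d)) i j : P.-integrable setT (EFin \o (fun s => G s x i j)).
Proof.
apply: eq_integrable (igrad i (row i x) j) => // s _.
by rewrite /= /G stoch_gradE.
Qed.

Let EG (x : 'M[R]_(n, d)) i j : (\int[P]_s G s x i j)%R = grad (total_obj f) x i j.
Proof.
rewrite grad_total_obj mxE /Rintegral.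
have := hgrad i (row i x) j; rewrite unlock.
by move=> E; under eq_integral do rewrite /G stoch_gradE; rewrite E.
Qed.

Let mean_gap (x z : 'M[R]_(n, d)) :
  mean_mx P (fun s => G s x - G s z) = grad (total_obj f) x - grad (total_obj f) z.
Proof.
apply/matrixP => i j; rewrite mxE; under eq_Rintegral do rewrite entryB.
by rewrite RintegralB// !EG entryB.
Qed.

Let mean_noise (z : 'M[R]_(n, d)) :
  mean_mx P (fun s => G s z - grad (total_obj f) z) = 0.
Proof.
apply/matrixP => i j; rewrite mxE; under eq_Rintegral do rewrite entryB.
rewrite RintegralB//; last exact: finite_measure_integrable_cst.
by rewrite EG Rintegral_cst_probability subrr mxE.
Qed.

Context (W : 'M[R]_n) (gamma omega : R) (l : 'I_n -> R).
Hypotheses (n_gt0 : (0 < n)%N).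
Hypotheses (Ws : W^T = W) (Wds : doubly_stochastic W) (hl : eigenvalues_of W l).
Hypotheses (hgamma : 0 <= gamma < 1) (homega : 0 <= omega <= 1).
Hypothesis hM : forall i j, neighborhood W gamma i i = neighborhood W gamma j j.
Context (mu L beta eta : R).
Hypotheses (mu0 : 0 <= mu) (L0 : 0 < L) (beta0 : 0 < beta) (eta0 : 0 < eta).
Hypotheses (fmu : forall i, strongly_convex mu (f i)) (fL : forall i, smooth L (f i)).
Hypothesis hbeta :
  loewner_le (laplacian (neighborhood W gamma)) (beta^-1 *: (laplacian W *m W)).
Hypothesis heta : eta <= Num.min (beta * omega / L)
  (1 / (4 * (((eff_neighbors l gamma)^-1 + omega) * zeta + L))).

Let a := (1 - omega) * (eff_neighbors l gamma)^-1 + omega.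

(** With [omega = 0] the first bound in [heta] would be 0, against [0 < eta]. Strict positivity
    makes an infinite variance yield an infinite right-hand side. *)
Lemma noise_coefficient_gt0 : 0 < a.
Proof.
have om : 0 < omega.
  have [_ om1] := andP homega; move: homega => /andP[+ _].
  rewrite le_eqVlt => /orP[/eqP om0|//]; move: heta.
  by rewrite le_min -om0 mulr0 mul0r leNgt eta0.
have := eff_neighborsV_ge0 W gamma l Ws Wds hl hgamma (Ordinal n_gt0) hM.
have [om0 om1] := andP homega.
by move=> e0; rewrite ltr_wpDl// mulr_ge0// subr_ge0.
Qed.

Lemma expected_descent (x z : 'M[R]_(n, d)) :
  eta *: grad (total_obj f) z + laplacian W *m z = 0 ->
  (\int[P]_s (lyapunov W gamma omega (x - (eta *: G s x + laplacian W *m x) - z))%:E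
   <= ((1 - eta * mu) * lyapunov W gamma omega (x - z))%:E
      + (eta ^+ 2)%:E * ((2 * a)%:E *
         \int[P]_s (sqnorm (G s z - grad (total_obj f) z))%:E))%E.
Proof.
move=> hz.
have a0 := noise_coefficient_gt0.
set A := lyapunov_mx W gamma omega.
have Aa i : A i i = a by exact: lyapunov_mx_diag.
have As : A^T = A by exact: (lyapunov_mx_sym _ _ _ _ Ws Wds hl).
have A0 (y : 'M[R]_(n, d)) : 0 <= qnorm A y by exact: (lyapunov_mx_ge0 _ _ _ _ Ws Wds hl).
have A1 (y : 'M[R]_(n, d)) : qnorm A y <= sqnorm y by exact: (lyapunov_mx_le _ _ _ _ Ws Wds hl).
set I := (\int[P]_s (sqnorm (G s z - _))%:E)%E.
have I0 : (0 <= I)%E by apply: integral_ge0 => s _; rewrite lee_fin sqnorm_ge0.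
have [Ioo|] := eqVneq I +oo%E.
  rewrite Ioo gt0_muley ?lte_fin ?mulr_gt0// gt0_muley ?lte_fin ?exprn_gt0//.
  by rewrite addey// leey.
rewrite -ltey => Ifin.
(* The fixed-point equation replaces [z - W *m z] by a gradient term, which centers the step at
   [W *m (x - z)]. *)
have step s : x - (eta *: G s x + laplacian W *m x) - z =
    W *m (x - z) - eta *: ((G s x - G s z) + (G s z - grad (total_obj f) z)).
  have -> : G s x - G s z + (G s z - grad (total_obj f) z) = G s x - grad (total_obj f) z.
    by rewrite addrA subrK.
  have ez : eta *: grad (total_obj f) z = - (z - W *m z).
    by apply/eqP; rewrite -addr_eq0 -{2}[z]mul1mx -mulmxBl; apply/eqP.
  rewrite scalerBr ez opprK /laplacian mulmxBl mul1mx mulmxBr.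
  by apply/matrixP => i j; move: (W *m x) (W *m z) (G s x) => Wx Wz g; rewrite !mxE; ring.
under eq_integral do rewrite lyapunov_qnorm step.
rewrite lyapunov_qnorm -/A.
have mV i j : measurable_fun setT (fun s => (G s z - grad (total_obj f) z) i j).
  exact: samplewise_measurable (sampleG z _).
have mU i j : measurable_fun setT (fun s => (G s x - G s z) i j).
  exact: samplewise_measurable (sampleGG x z).
set D := \sum_i bregman (f i) (row i z) (row i x).
have V2 : P.-integrable setT (EFin \o (fun s => sqnorm (G s z - grad (total_obj f) z))).
  apply/integrableP; split; first by apply/measurable_EFinP; exact: measurable_sqnorm.
  by under eq_integral do rewrite /= ger0_norm ?sqnorm_ge0//.
have Ule := expected_grad_gap_le x z.
have U2 : P.-integrable setT (EFin \o (fun s => sqnorm (G s x - G s z))).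
  apply/integrableP; split; first by apply/measurable_EFinP; exact: measurable_sqnorm.
  under eq_integral do rewrite /= ger0_norm ?sqnorm_ge0//.
  exact: le_lt_trans Ule (ltry _).
apply: le_trans (integral_step_le P xi indxi A a Aa As A0 A1 (ltW a0) _ _ _ _
  (sampleGG x z) (sampleG z _) U2 V2 (mean_noise z)) _.
rewrite mean_gap.
have IE : I = ((\int[P]_s sqnorm (G s z - grad (total_obj f) z))%R)%:E.
  by rewrite /Rintegral fineK// ge0_fin_numE.
rewrite IE -!EFinM -EFinD lee_fin lerD2r.
set EU := (\int[P]_s sqnorm (G s x - G s z))%R.
have EUle : EU <= 2 * (zeta * D).
  by rewrite -lee_fin /EU /Rintegral fineK//; exact: (integrable_fin_num _ U2).
have EU0 : 0 <= EU by apply: Rintegral_ge0 => s _; exact: sqnorm_ge0.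
have df i v : differentiable (f i) v by have [+ _] := fL i.
have bf0 i u v : 0 <= bregman (f i) u v.
  apply: le_trans (strongly_convex_bregman mu _ _ _ (fmu i) (df i _)).
  by rewrite mulr_ge0 ?sqnorm_ge0// divr_ge0.
have D0 : 0 <= D by apply: sumr_ge0 => i _.
have hD : sqnorm (grad (total_obj f) x - grad (total_obj f) z) <= 2 * L * D.
  rewrite sqnorm_rows mulr_sumr; apply: ler_sum => i _.
  rewrite !grad_total_obj linearB /= !rowK -sqnormN opprB.
  exact: sqnorm_grad_gap_le.
move: heta; rewrite le_min => /andP[eta1 eta2].
have etaL : eta * L <= beta * omega by rewrite -ler_pdivlMr.
apply: le_trans (total_descent W gamma omega l Ws Wds hl hgamma homega f mu L beta eta
  mu0 beta0 eta0 fmu fL hbeta etaL x z).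
rewrite lerD2l -/D.
set h := sqnorm _ in hD *; set aa := (eff_neighbors l gamma)^-1 + omega in eta2 *.
have aale : a <= aa.
  rewrite /a /aa lerD2r ler_piMl ?gerBl//; last by case/andP: homega.
  exact: (eff_neighborsV_ge0 W gamma l Ws Wds hl hgamma (Ordinal n_gt0) hM).
(* The sign of [zeta] is not given. A nonpositive denominator, including 0 with its inverse 0, would
   make the bound on [eta] nonpositive. Likewise [zD] below comes from a nonnegative expectation. *)
have den : 0 < aa * zeta + L.
  rewrite ltNge; apply/negP => den; have : 1 / (4 * (aa * zeta + L)) <= 0.
    by rewrite div1r invr_le0 mulr_ge0_le0.
  by move=> /(le_trans eta2); rewrite leNgt eta0.
have eta4 : eta * (4 * (aa * zeta + L)) <= 1 by rewrite -ler_pdivlMr ?mulr_gt0.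
have zD : 0 <= zeta * D by have := le_trans EU0 EUle; rewrite pmulr_rge0.
have t1 : h + a * EU <= 2 * L * D + 2 * (aa * (zeta * D)).
  apply: lerD => //; apply: le_trans (ler_wpM2l (ltW a0) EUle) _.
  by rewrite mulrCA ler_pM2l// ler_wpM2r.
have t2 := ler_wpM2r (mulr_ge0 (ltW eta0) D0) eta4.
have t3 := ler_wpM2l (mulr_ge0 (ler0n R 2) (sqr_ge0 eta)) t1.
apply: le_trans t3 _.
rewrite mul1r in t2; apply: le_trans t2.
by rewrite le_eqVlt; apply/orP; left; apply/eqP; ring.
Qed.

End expected_descent.

(** * Conditional descent *)

Lemma measurable_g_sigma_le {T : pointedType} {d'} {U : measurableType d'}
    (G1 G2 : set (set T)) (g : T -> U) : <<s G1>> `<=` <<s G2>> ->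
  measurable_fun setT (g : g_sigma_algebraType G1 -> U) ->
  measurable_fun setT (g : g_sigma_algebraType G2 -> U).
Proof. by move=> G12 mg mT B mB; apply: G12; exact: mg. Qed.

Section dsgd_measurable.
Context {disp : measure_display} {Omega : measurableType disp} {R : realType}.
Context {n d : nat} {dXi} {Xi : measurableType dXi} (W : 'M[R]_n) (eta : R).
Context (fs : Xi -> 'rV[R]_d -> R) (zetas : Xi -> R) (x0 : 'M[R]_(n, d)).
Hypothesis mfs : forall x, measurable_fun setT (fun z => fs z x).
Hypothesis sfs : forall z, smooth (zetas z) (fs z).
Context (xi : nat -> 'I_n -> Omega -> Xi).

Let X (ti : nat * 'I_n) := xi ti.1 ti.2.

Lemma measurable_sigma_gen {I : Type} (Z : I -> Omega -> Xi) (J : set I) i : J i ->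
  measurable_fun setT (Z i : g_sigma_algebraType (sigma_gen Z J) -> Xi).
Proof.
move=> Ji mT B mB; rewrite setTI; apply: sub_sigma_algebra.
by exists i, B; split.
Qed.

Lemma measurable_dsgd_step {dT} {T : measurableType dT} (x : T -> 'M[R]_(n, d))
    (z : 'I_n -> T -> Xi) i j :
  (forall i, measurable_fun setT (z i)) ->
  (forall i j, measurable_fun setT (fun s => x s i j)) ->
  measurable_fun setT (fun s =>
    (x s - (eta *: stoch_grad fs (z^~ s) (x s) + laplacian W *m x s)) i j).
Proof.
move=> mz mx.
have -> : (fun s => (x s - (eta *: stoch_grad fs (z^~ s) (x s) + laplacian W *m x s)) i j) =
    (fun s => x s i j - (eta * stoch_grad fs (z^~ s) (x s) i j
                         + \sum_k laplacian W i k * x s k j)).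
  apply/funext => s; rewrite entryB; congr (_ - _).
  by rewrite mxE; congr (_ + _); rewrite mxE.
apply: measurable_funB => //; apply: measurable_funD.
  by apply: measurable_funM => //; exact: (measurable_stoch_grad fs zetas).
by apply: measurable_sum => k; exact: measurable_funM.
Qed.

(** Adaptedness to the past, expressed as plain measurability by putting the sigma-algebra of the
    earlier samples on the domain. *)
Lemma measurable_dsgd t i j :
  measurable_fun setT
    ((fun s => dsgd W eta fs (fun t' i => xi t' i s) x0 t i j) :
      g_sigma_algebraType (sigma_gen X [set ti | (ti.1 < t)%N]) -> R).
Proof.
elim: t i j => [|t IH] i j; first exact: measurable_cst.
apply: (measurable_dsgd_step (T := g_sigma_algebraType (sigma_gen X [set ti | (ti.1 < t.+1)%N]))
  (fun s => dsgd W eta fs (fun t' i => xi t' i s) x0 t) (fun i s => xi t i s)).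
- by move=> k; apply: (measurable_sigma_gen X _ (t, k)) => /=.
- move=> k l; apply: measurable_g_sigma_le (IH k l).
  apply: sub_sigma_algebra2 => _ [ti [B [tit mB ->]]].
  by exists ti, B; split => //=; exact: ltnW.
Qed.

End dsgd_measurable.

Section conditional_bound.
Context {disp : measure_display} {Omega : measurableType disp} {R : realType}.
Variable P : probability Omega R.

Lemma integral_indic (B : set Omega) (g : Omega -> R) :
  (\int[P]_(s in B) (g s)%:E = \int[P]_s (\1_B s * g s)%:E)%E.
Proof.
rewrite integral_mkcond; apply: eq_integral => s _; rewrite patchE indicE.
by case: (s \in B); rewrite ?mul1r ?mul0r.
Qed.

Lemma integral_boolM_le (b : bool) (g : Omega -> R) (c : R) :
  (\int[P]_s (g s)%:E <= c%:E)%E -> (\int[P]_s (b%:R * g s)%:E <= (b%:R * c)%:E)%E.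
Proof.
case: b => gc; first by under eq_integral do rewrite mul1r; rewrite mul1r.
by under eq_integral do rewrite mul0r; rewrite integral0 mul0r.
Qed.

(* If [Y > r] with positive probability, then for some [k] the event
   [r <= k, r + 1/(k+1) <= Y] of the sub-sigma-algebra has positive probability,
   and the integrals of [Y] and [r] over it are finite and contradict [H]. *)
Lemma ae_le_of_integral_le (G : set (set Omega)) (Y : Omega -> \bar R) (r : Omega -> R) :
  G `<=` measurable -> (forall s, 0 <= r s) ->
  measurable_fun setT (Y : g_sigma_algebraType G -> \bar R) ->
  measurable_fun setT (r : g_sigma_algebraType G -> R) ->
  (forall B, <<s G>> B -> (\int[P]_(s in B) Y s <= \int[P]_(s in B) (r s)%:E)%E) ->
  {ae P, forall s, (Y s <= (r s)%:E)%E}.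
Proof.
move=> Gm r0 mY mr H.
have sGm : <<s G>> `<=` measurable.
  by apply: smallest_sub; [exact: sigma_algebra_measurable|].
have mYO : measurable_fun setT Y by move=> mT B mB; apply: sGm; exact: mY.
have mrO : measurable_fun setT r by move=> mT B mB; apply: sGm; exact: mr.
pose e (k : nat) : R := k.+1%:R^-1.
have e0 k : 0 < e k by rewrite invr_gt0 ltr0n.
pose B k := [set s | ((r s)%:E <= k%:R%:E)%E /\ ((r s + e k)%:E <= Y s)%E].
have sB k : <<s G>> (B k).
  have -> : B k = (setT `&` [set s | ((r s)%:E <= k%:R%:E)%E]) `&`
     (setT `&` [set s | ((r s + e k)%:E <= Y s)%E]) by rewrite !setTI.
  apply: (@measurableI _ (g_sigma_algebraType G)).
    by apply: (@measurable_lee _ (g_sigma_algebraType G)) => //; exact/measurable_EFinP.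
  apply: (@measurable_lee _ (g_sigma_algebraType G)) => //; apply/measurable_EFinP.
  exact: measurable_funD.
have PB k : P (B k) = 0%E.
  have mB := sGm _ (sB k).
  have rfin : (\int[P]_(s in B k) (r s)%:E)%E \is a fin_num.
    rewrite ge0_fin_numE; last by apply: integral_ge0 => s _; rewrite lee_fin.
    apply: (@le_lt_trans _ _ (\int[P]_(s in B k) (k%:R : R)%:E)%E).
      apply: ge0_le_integral => //.
      - by move=> s _; rewrite lee_fin.
      - by apply/measurable_EFinP; exact: measurable_funTS.
      - by move=> s [].
    rewrite integral_cst//; apply: lte_mul_pinfty => //.
    by rewrite -ge0_fin_numE ?fin_num_measure.
  have : (\int[P]_(s in B k) (r s + e k)%:E <= \int[P]_(s in B k) (r s)%:E)%E.
    apply: le_trans (H _ (sB k)); apply: ge0_le_integral => //.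
    - by move=> s _; rewrite lee_fin addr_ge0// ltW.
    - apply/measurable_EFinP; apply: measurable_funD => //; exact: measurable_funTS.
    - exact: measurable_funTS.
    - by move=> s [].
  under eq_integral do rewrite EFinD.
  rewrite ge0_integralD//; last 3 first.
  - by move=> s _; rewrite lee_fin.
  - by apply/measurable_EFinP; exact: measurable_funTS.
  - by move=> s _; rewrite lee_fin ltW.
  move=> rle; have PB0 : ((e k)%:E * P (B k) <= 0)%E.
    by move: rle; rewrite integral_cst// -[leRHS]adde0 leeD2lE.
  apply/eqP; rewrite -measure_le0 -(@pmule_rle0 _ (e k)%:E)//.
  by rewrite lte_fin.
have : P.-negligible (\bigcup_k B k).
  apply: negligible_bigcup => k.
  by exists (B k); split; [exact: (sGm _ (sB k))|exact: PB|].
apply: negligibleS => s /= /negP; rewrite -ltNge => rY.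
have [k [hk1 hk2]] : exists k : nat, r s <= k%:R /\ ((r s + e k)%:E <= Y s)%E.
  move: rY; case: (Y s) => [y| |] //.
  - rewrite lte_fin => ry.
    have yr0 : 0 < y - r s by rewrite subr_gt0.
    (* The sum dominates both [r s] and the inverse gap, so one [k] meets both conditions of
       [B k]. *)
    pose k := (Num.trunc (r s) + Num.trunc (y - r s)^-1).+1.
    exists k; split.
      apply: le_trans (ltW (truncnS_gt _)) _.
      by rewrite ler_nat /k ltnS leq_addr.
    rewrite lee_fin -lerBrDl /e -[leRHS]invrK lef_pV2 ?posrE ?ltr0n ?invr_gt0//.
    apply: le_trans (ltW (truncnS_gt _)) _.
    by rewrite ler_nat /k ltnS (leq_trans _ (leqnSn _))// leq_addl.
  - move=> _; exists (Num.trunc (r s)).+1; rewrite leey; split => //.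
    exact/ltW/truncnS_gt.
by exists k.
Qed.

End conditional_bound.

Theorem theorem6 (R : realType) (n d : nat) (hn : (0 < n)%N)
  (disp dispXi : measure_display)
  (Omega : measurableType disp) (P : probability Omega R)
  (Xi : measurableType dispXi)
  (W : 'M[R]_n) (hWsym : W^T = W) (hWds : doubly_stochastic W)
  (f : 'I_n -> 'rV[R]_d -> R)
  (fs : Xi -> 'rV[R]_d -> R) (zetas : Xi -> R)
  (hfs_meas : forall x : 'rV[R]_d, measurable_fun setT (fun z => fs z x))
  (hzetas_meas : measurable_fun setT zetas)
  (xi : nat -> 'I_n -> {RV P >-> Xi})
  (hxi_dist : forall (i : 'I_n) (t t' : nat) (A : set Xi), measurable A ->
     distribution P (xi t i) A = distribution P (xi t' i) A)
  (hxi_indep : independent_family P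
     (fun (ti : nat * 'I_n) (s : Omega) => xi ti.1 ti.2 s))
  (hunb_int : forall (t : nat) (i : 'I_n) (x : 'rV[R]_d),
     P.-integrable setT (fun s => (fs (xi t i s) x)%:E))
  (hunb : forall (t : nat) (i : 'I_n) (x : 'rV[R]_d),
     ('E_P[fun s => fs (xi t i s) x] = (f i x)%:E)%E)
  (hgunb_int : forall (t : nat) (i : 'I_n) (x : 'rV[R]_d) (j : 'I_d),
     P.-integrable setT (fun s => (grad (fs (xi t i s)) x ord0 j)%:E))
  (hgunb : forall (t : nat) (i : 'I_n) (x : 'rV[R]_d) (j : 'I_d),
     ('E_P[fun s => grad (fs (xi t i s)) x ord0 j] = (grad (f i) x ord0 j)%:E)%E)
  (hfs_cvx : forall z : Xi, convex (fs z))
  (hfs_smooth : forall z : Xi, smooth (zetas z) (fs z))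
  (zeta : R)
  (hzeta : forall (t : nat) (i : 'I_n) (x y : 'rV[R]_d),
     ('E_P[fun s => (zetas (xi t i s) * bregman (fs (xi t i s)) x y)%R]
       <= (zeta * bregman (f i) x y)%:E)%E)
  (mu L : R) (hmu : 0 <= mu) (hL : 0 < L)
  (hf_cvx : forall i : 'I_n, strongly_convex mu (f i))
  (hf_smooth : forall i : 'I_n, smooth L (f i))
  (gamma : R) (hgamma : 0 <= gamma < 1)
  (hM : forall i j : 'I_n, neighborhood W gamma i i = neighborhood W gamma j j)
  (lambda : 'I_n -> R) (hlambda : eigenvalues_of W lambda)
  (beta : R) (hbeta0 : 0 < beta)
  (hbeta : loewner_le (laplacian (neighborhood W gamma))
             (beta^-1 *: (laplacian W *m W)))
  (omega : R) (homega : 0 <= omega <= 1)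
  (eta : R) (heta0 : 0 < eta)
  (heta : eta <= Num.min (beta * omega / L)
     (1 / (4 * (((eff_neighbors lambda gamma)^-1 + omega) * zeta + L))))
  (x0 xstar : 'M[R]_(n, d))
  (hxstar : eta *: grad (total_obj f) xstar + laplacian W *m xstar = 0) :
  let x (t : nat) (s : Omega) : 'M[R]_(n, d) :=
    dsgd W eta fs (fun t' i => xi t' i s) x0 t in
  let Lt (t : nat) (s : Omega) : R := lyapunov W gamma omega (x t s - xstar) in
  let sigma2 (t : nat) : \bar R :=
    ((2 * ((1 - omega) * (eff_neighbors lambda gamma)^-1 + omega))%:E *
     'E_P[fun s => sqnorm (stoch_grad fs (fun i => xi t i s) xstar
                           - grad (total_obj f) xstar)%R])%E in
  forall (t : nat) (Y : Omega -> \bar R),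
    is_cond_exp P (sigma_mx (x t)) (fun s => (Lt t.+1 s)%:E) Y ->
    {ae P, forall s,
      (Y s <= ((1 - eta * mu) * Lt t s)%:E + (eta ^+ 2)%:E * sigma2 t)%E}.
Proof.
move=> x Lt sigma2 t Y [Ymeas Yint].
pose X (ti : nat * 'I_n) (s : Omega) := xi ti.1 ti.2 s.
(* [H] generates the past and [K] the present; their index sets are disjoint, and the conditioning
   sigma-algebra generated by [Gx] lies in the past ([GH]). *)
pose H := sigma_gen X [set ti | (ti.1 < t)%N].
pose K := sigma_gen X [set ti | ti.1 = t].
pose Gx := [set A | exists i j (B : set R),
  measurable B /\ A = (fun s => x t s i j) @^-1` B].
have mX ti : measurable_fun setT (X ti) by exact: measurable_funPT.
have sHm : <<s H>> `<=` measurable by exact: sigma_gen_sub.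
have sKm : <<s K>> `<=` measurable by exact: sigma_gen_sub.
have indHK E1 E2 : <<s H>> E1 -> <<s K>> E2 -> P (E1 `&` E2) = (P E1 * P E2)%E.
  apply: (independent_sigma P X mX hxi_indep).
  by apply/seteqP; split => // ti /= [+ tit]; rewrite tit ltnn.
have indxi i k (B C : set Xi) : i != k -> measurable B -> measurable C ->
    P (xi t i @^-1` B `&` xi t k @^-1` C) = (P (xi t i @^-1` B) * P (xi t k @^-1` C))%E.
  move=> ik mB mC; apply: (independent_sigma P X mX hxi_indep [set (t, i)] [set (t, k)]).
  - by apply/seteqP; split => // _ /= [-> []] /eqP; rewrite (negbTE ik).
  - by apply: sub_sigma_algebra; exists (t, i), B.
  - by apply: sub_sigma_algebra; exists (t, k), C.
have mxt i j : measurable_fun setT ((fun s => x t s i j) : g_sigma_algebraType H -> R).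
  exact: (measurable_dsgd W eta fs zetas x0 hfs_meas hfs_smooth (fun t' i s => xi t' i s)).
have GH : <<s Gx>> `<=` <<s H>>.
  apply: smallest_sub; first exact: smallest_sigma_algebra.
  move=> _ [i [j [B [mB ->]]]]; rewrite -[X in <<s H>> X]setTI; exact: mxt.
have mxG i j : measurable_fun setT ((fun s => x t s i j) : g_sigma_algebraType Gx -> R).
  by move=> mT B mB; rewrite setTI; apply: sub_sigma_algebra; exists i, j, B.
have mY : measurable_fun setT (Y : g_sigma_algebraType Gx -> \bar R).
  by move=> mT B mB; rewrite setTI; exact: Ymeas.
pose a : R := (1 - omega) * (eff_neighbors lambda gamma)^-1 + omega.
have a0 : 0 < a.
  exact: (noise_coefficient_gt0 zeta W gamma omega lambda hn hWsym hWds hlambda hgamma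
    homega hM L beta eta heta0 heta).
have sigma2E : sigma2 t = ((2 * a)%:E * \int[P]_s
    (sqnorm (stoch_grad fs (fun i => xi t i s) xstar - grad (total_obj f) xstar))%:E)%E.
  by rewrite /sigma2 unlock.
have sigma2_ge0 : (0 <= sigma2 t)%E.
  rewrite sigma2E; apply: mule_ge0; first by rewrite lee_fin mulr_ge0// ltW.
  by apply: integral_ge0 => s _; rewrite lee_fin sqnorm_ge0.
(* An infinite variance makes the bound trivial; otherwise it is a real function [r] of the iterate,
   as [ae_le_of_integral_le] requires. *)
have [soo|] := eqVneq (sigma2 t) +oo%E.
  by apply: aeW => s; rewrite soo gt0_muley ?lte_fin ?exprn_gt0// addey// leey.
rewrite -ltey -ge0_fin_numE// => sfin.
pose r (v : 'M[R]_(n, d)) : R :=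
  (1 - eta * mu) * lyapunov W gamma omega (v - xstar) + eta ^+ 2 * fine (sigma2 t).
have rE v : (r v)%:E = (((1 - eta * mu) * lyapunov W gamma omega (v - xstar))%:E
    + (eta ^+ 2)%:E * sigma2 t)%E by rewrite -[in RHS](fineK sfin) -EFinM -EFinD.
pose next (v : 'M[R]_(n, d)) (s : Omega) : R := lyapunov W gamma omega
  (v - (eta *: stoch_grad fs (fun i => xi t i s) v + laplacian W *m v) - xstar).
have next_ge0 v s : 0 <= next v s.
  by rewrite /next lyapunov_qnorm; exact: (lyapunov_mx_ge0 _ _ _ _ hWsym hWds hlambda).
have descent v : (\int[P]_s (next v s)%:E <= (r v)%:E)%E.
  rewrite rE sigma2E.
  exact: (expected_descent P (xi t) indxi f fs zetas hfs_meas hzetas_meas hfs_cvx hfs_smooth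
    zeta (hzeta t) (hgunb_int t) (hgunb t) W gamma omega lambda hn hWsym hWds hlambda
    hgamma homega hM mu L beta eta hmu hL hbeta0 heta0 hf_cvx hf_smooth hbeta heta).
have r_ge0 v : 0 <= r v.
  by rewrite -lee_fin; apply: le_trans (descent v); apply: integral_ge0 => s _; rewrite lee_fin.
have mr (G : set (set Omega)) (z : Omega -> 'M[R]_(n, d)) :
    (forall i j, measurable_fun setT ((fun s => z s i j) : g_sigma_algebraType G -> R)) ->
    measurable_fun setT ((fun s => r (z s)) : g_sigma_algebraType G -> R).
  move=> mz; apply: measurable_funD => //; apply: measurable_funM => //.
  under eq_fun do rewrite lyapunov_qnorm.
  apply: measurable_qnorm => i j; under eq_fun do rewrite entryB.
  exact: measurable_funB.
suff : {ae P, forall s, (Y s <= (r (x t s))%:E)%E}.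
  by apply: filterS => s; rewrite rE.
apply: (ae_le_of_integral_le P Gx) => //.
- by move=> C GC; apply: sHm; apply: GH; apply: sub_sigma_algebra.
- exact: mr.
move=> B GB; rewrite (Yint _ GB); have HB := GH _ GB.
(* The identity, read into [Omega] with the past and with the present sigma-algebra, gives two
   independent random elements. The next Lyapunov value is then jointly measurable, taking the
   iterate from the first copy and the samples from the second. *)
have mIdH : measurable_fun setT (idfun : Omega -> g_sigma_algebraType H).
  by move=> mT C mC; rewrite setTI; exact: sHm.
have mIdK : measurable_fun setT (idfun : Omega -> g_sigma_algebraType K).
  by move=> mT C mC; rewrite setTI; exact: sKm.
pose idH : {mfun Omega >-> g_sigma_algebraType H} :=
  HB.pack (idfun : Omega -> g_sigma_algebraType H) (isMeasurableFun.Build _ _ _ _ _ mIdH).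
pose idK : {mfun Omega >-> g_sigma_algebraType K} :=
  HB.pack (idfun : Omega -> g_sigma_algebraType K) (isMeasurableFun.Build _ _ _ _ _ mIdK).
rewrite (integral_indic P B (Lt t.+1)) (integral_indic P B (fun s => r (x t s))).
apply: (independent_integral_le P idH idK _
  (fun z => (\1_B z.1 * next (x t z.1) z.2)%:E) (fun s => (\1_B s * r (x t s))%:E)).
- by move=> E1 E2 mE1 mE2; exact: indHK.
- apply/measurable_EFinP; apply: measurable_funM.
    apply: (measurableT_comp (f := \1_B : g_sigma_algebraType H -> R)) => //.
  under eq_fun do rewrite /next lyapunov_qnorm.
  apply: measurable_qnorm => i j; under eq_fun do rewrite entryB.
  apply: measurable_funB => //.
  apply: (measurable_dsgd_step W eta fs zetas hfs_meas hfs_smooth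
    (fun z : g_sigma_algebraType H * g_sigma_algebraType K => x t z.1)
    (fun i z => xi t i z.2)).
  + move=> k; apply: (measurableT_comp (f := (xi t k : g_sigma_algebraType K -> Xi))) => //.
    exact: (measurable_sigma_gen X [set ti | ti.1 = t] (t, k)).
  + move=> k l.
    exact: (measurableT_comp (f := (fun s => x t s k l) : g_sigma_algebraType H -> R)).
- by move=> z; rewrite lee_fin mulr_ge0.
- apply/measurable_EFinP; apply: measurable_funM; last exact: mr.
  exact: measurable_indic.
(* With the past frozen, the indicator of [B] is a constant 0 or 1 and the iterate a fixed matrix,
   so the deterministic bound applies. *)
- by move=> v; rewrite indicE; exact: (integral_boolM_le P _ _ _ (descent (x t v))).
Qed.
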